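(* Let $$C_9=\sum_{m,n=0}^\infty(-1)^{m+n}(2m+1)(2n+1)\,\mathrm{sech}\left(\sqrt{2m(m+1)+2n(n+1)+1}\;\frac{\pi}{\sqrt2}\right).$$ Then $$\int_0^\infty\eta^9(ix)\,dx=C_9.$$
   Context: Here $\eta$ is the Dedekind eta function, $\eta(\tau)=e^{\pi i\tau/12}\prod_{n=1}^\infty(1-e^{2\pi i n\tau})$ for $\mathrm{Im}\,\tau>0$, so for $x>0$, $\eta(ix)=q^{1/24}\prod_{n\ge1}(1-q^n)$ with $q=e^{-2\pi x}$; $\eta^k(ix)$ means $(\eta(ix))^k$. $\mathrm{sech}=1/\cosh$. *)

(* Defs.v *)
From HB Require Import structures.
From mathcomp Require Import all_boot all_order all_algebra.
From mathcomp Require Import all_classical all_reals all_analysis.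
From mathcomp Require Import complex.
Set Implicit Arguments.
Unset Strict Implicit.
Unset Printing Implicit Defensive.
Import Order.TTheory GRing.Theory Num.Theory.
Import numFieldNormedType.Exports.
Local Open Scope classical_set_scope.
Local Open Scope ring_scope.
Local Open Scope complex_scope.

Definition cosh (R : realType) (x : R) : R := (expR x + expR (- x)) / 2.

Definition sech (R : realType) (x : R) : R := (cosh x)^-1.

Definition cexp (R : realType) (z : R[i]) : R[i] :=
  (expR (complex.Re z))%:C * (cos (complex.Im z) +i* sin (complex.Im z)).

(* Meaningful for 0 < Im tau.  The ascription to the regular module R[i]^o
   equips R[i] with the topology of the complex modulus, in which the limit of
   the partial products is taken. *)
Definition dedekind_eta (R : realType) (tau : R[i]) : R[i] :=
  cexp ((@pi R)%:C * 'i * tau / 12%:R) *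
  limn (fun N : nat =>
    (\prod_(1 <= n < N.+1) (1 - cexp (2%:R * (@pi R)%:C * 'i * n%:R * tau))
     : R[i]^o)).

(* Lebesgue integrability and integral of a complex-valued function of a real
   variable, componentwise. *)
Definition cintegrable (R : realType) (D : set R) (f : R -> R[i]) : Prop :=
  (@lebesgue_measure R).-integrable D (fun x => (complex.Re (f x))%:E) /\
  (@lebesgue_measure R).-integrable D (fun x => (complex.Im (f x))%:E).

Definition cintegral (R : realType) (D : set R) (f : R -> R[i]) : R[i] :=
  (\int[@lebesgue_measure R]_(x in D) complex.Re (f x)) +i*
  (\int[@lebesgue_measure R]_(x in D) complex.Im (f x)).

Definition C9_term (R : realType) (m n : nat) : R :=
  (-1) ^+ (m + n) * (2 * m + 1)%:R * (2 * n + 1)%:R *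
  sech (Num.sqrt (2 * m * (m + 1) + 2 * n * (n + 1) + 1)%:R *
        (pi / Num.sqrt 2)).

(* Iterated sum; its value is that of the double sum when the family
   (m, n) |-> C9_term R m n is absolutely summable. *)
Definition C9 (R : realType) : R :=
  limn (series (fun m => limn (series (C9_term R m)))).

(* Main.v *)
Require Import Defs.
From HB Require Import structures.
From mathcomp Require Import all_boot all_order all_algebra.
From mathcomp Require Import all_classical all_reals all_analysis.
From mathcomp Require Import measurable_realfun complex.
From mathcomp Require Import zify ring lra.
Set Implicit Arguments.
Unset Strict Implicit.
Unset Printing Implicit Defensive.
Import Order.TTheory GRing.Theory Num.Theory.
Import numFieldNormedType.Exports.
Local Open Scope classical_set_scope.
Local Open Scope ring_scope.

(* Write [eta(ix) ^ 3 = \sum_n w_n exp (- l_n x)] with [w_n = (-1)^n (2n+1)] and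
   [l_n = pi (2n+1)^2 / 4] (Jacobi, obtained as the limit of a finite form of
   the triple product differentiated at [z = 1]).  Integrating this against
   [exp (- a x)] term by term yields [\sum_n w_n / (l_n + a)], which is the
   partial fraction expansion of [sech (sqrt (pi a))].  Expanding the other two
   factors [eta(ix) ^ 3] of [eta(ix) ^ 9] then gives the double series.  Each
   expansion is integrated by dominated convergence: since [w_n] alternates,
   partial summation bounds [|\sum_(n < N) w_n exp (- l_n x)|] by
   [\sum_n exp (- l_n x)], without the weights, and as [eta(ix) >= 0] the
   integrals of the dominating functions are again given by the sech formula. *)

(** * Derivatives and elementary trigonometry *)

(** The obstacle is conditional convergence: with its weights, [\sum_n (2n+1) / (l_n + a)] diverges
    like the harmonic series, so Fubini cannot exchange sum and integral, whereas
    [\sum_n 1 / (l_n + a)] converges. Hence one cube is expanded at a time, the remaining integrand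
    staying a nonnegative factor [f]; this order produces exactly the iterated limits of [C9].

    The sech expansion is proved with real variables only. The integral over [[0, pi / 2]] of
    [\sum_(n < N) cos ((2n+1) t)] times [cosh (y t)] equals [cosh (y pi / 2)] times a partial sum of
    the wanted series, and the kernel concentrates at 0, where [cosh] is 1, so the limit is
    [pi / 4].

    The variable [z] of the triple product occurs in no statement: multiplication by its two new
    factors becomes a three-term recurrence on coefficients, and differentiation at [z = 1] becomes
    a weighted sum of them. *)

Lemma mvt_bound (R : realType) (f df : R -> R) (a b M : R) : a <= b ->
  (forall x, a <= x <= b -> is_derive x 1 f (df x)) ->
  (forall x, a <= x <= b -> `|df x| <= M) ->
  `|f b - f a| <= M * (b - a).
Proof.
move=> ab fdf dfM.
have cf : {within `[a, b], continuous f}.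
  apply: derivable_within_continuous => x; rewrite in_itv/= => /fdf h.
  exact: ex_derive.
have [|c] := @MVT_segment R f df a b ab _ cf.
  by move=> x; rewrite in_itv/= => /andP[ax xb]; apply: fdf; rewrite !ltW.
rewrite in_itv/= => /dfM cM ->.
by rewrite normrM (ger0_norm (x := b - a)) ?subr_ge0// ler_wpM2r// subr_ge0.
Qed.

Section DeriveFun.
Context {R : realType}.
Implicit Types (f g : R -> R) (x c : R).

Lemma is_derive_funD f g x df dg : is_derive x 1 f df -> is_derive x 1 g dg ->
  is_derive x 1 (fun t => f t + g t) (df + dg).
Proof. exact: is_deriveD. Qed.

Lemma is_derive_funB f g x df dg : is_derive x 1 f df -> is_derive x 1 g dg ->
  is_derive x 1 (fun t => f t - g t) (df - dg).
Proof. exact: is_deriveB. Qed.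

Lemma is_derive_funM f g x df dg : is_derive x 1 f df -> is_derive x 1 g dg ->
  is_derive x 1 (fun t => f t * g t) (f x * dg + g x * df).
Proof. exact: is_deriveM. Qed.

Lemma is_derive_funZ c f x df : is_derive x 1 f df ->
  is_derive x 1 (fun t => c * f t) (c * df).
Proof. exact: is_deriveZ. Qed.

Lemma is_derive_funV f x df : f x != 0 -> is_derive x 1 f df ->
  is_derive x 1 (fun t => (f t)^-1) (- df / f x ^+ 2).
Proof.
move=> fx0 dfx; have h := is_deriveV fx0 dfx.
by apply: (is_derive_eq h); rewrite -[LHS]/(_ * _) mulrC mulrN mulNr.
Qed.

Lemma is_derive_dilate c f x df : is_derive (c * x) 1 f df ->
  is_derive x 1 (fun t => f (c * t)) (c * df).
Proof.
move=> dfx.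
have h : is_derive x 1 (fun t : R => c * t) c.
  have := @is_derive_funZ c id x 1 (is_derive_id _ _).
  by rewrite mulr1.
by rewrite mulrC; exact: (@is_derive1_comp R f (fun t : R => c * t) x df c dfx h).
Qed.

Lemma is_derive_funsum n (F dF : nat -> R -> R) x :
  (forall k, is_derive x 1 (F k) (dF k x)) ->
  is_derive x 1 (fun t => \sum_(k < n) F k t) (\sum_(k < n) dF k x).
Proof.
move=> dFk; elim: n => [|n IH].
  by rewrite big_ord0; under eq_fun do rewrite big_ord0; exact: is_derive_cst.
under eq_fun do rewrite big_ord_recr.
by rewrite big_ord_recr; exact: is_derive_funD.
Qed.

End DeriveFun.

Section Trig.
Context {R : realType}.
Implicit Types (t x y : R).

Lemma ler_mul_cos_sin t : 0 <= t <= pi / 2 -> t * cos t <= sin t.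
Proof.
move=> /andP[t0 tpi].
have cf : {within `[0, t], continuous (@sin R)}.
  exact/continuous_subspaceT/continuous_sin.
have [c] := @MVT_segment R sin cos 0 t t0 (fun x _ => is_derive_sin x) cf.
rewrite in_itv/= sin0 !subr0 => /andP[c0 ct] ->.
rewrite mulrC ler_wpM2r// //.
have hpi : pi / 2 <= pi :> R by have := @pi_ge0 R; lra.
by have [->//|ne] := eqVneq c t; apply/ltW; rewrite ltr_cos ?in_itv/=
  ?lt_neqAle ?ne ?t0 ?c0 ?ct ?(le_trans tpi)// (le_trans ct)// (le_trans tpi).
Qed.

(** Doubling the angle in [ler_mul_cos_sin] gives [sin t >= t cos (t/2) ^ 2 = t (1 + cos t) / 2].
    The constant 1/2 is below the optimal [2 / pi], but it is just what yields
    [1 / (2 sin t) <= 1 / t]. *)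
Lemma ler_half_sin t : 0 <= t <= pi / 2 -> t / 2 <= sin t.
Proof.
move=> /andP[t0 tpi].
have tE : t = (t / 2) *+ 2 by rewrite -mulr_natr divfK.
have h : t / 2 * cos (t / 2) <= sin (t / 2).
  by apply: ler_mul_cos_sin; have := @pi_ge0 R; lra.
have c0 : 0 <= cos (t / 2).
  by apply: cos_ge0_pihalf; have := @pi_ge0 R; lra.
rewrite [in leRHS]tE sin_mulr2n.
apply: (@le_trans _ _ ((cos (t / 2) * (t / 2 * cos (t / 2))) *+ 2)); last first.
  by rewrite lerMn2r ler_wpM2l.
have -> : cos (t / 2) * (t / 2 * cos (t / 2)) *+ 2 = t / 2 * (cos (t / 2) ^+ 2 *+ 2).
  by rewrite expr2 !mulr2n; ring.
have -> : cos (t / 2) ^+ 2 *+ 2 = cos t + 1.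
  by rewrite [in RHS]tE cos_mulr2n subrK.
rewrite ler_peMr//; first by rewrite divr_ge0.
by rewrite lerDr; apply: cos_ge0_pihalf; rewrite tpi andbT; have := @pi_ge0 R; lra.
Qed.

Lemma sin_natpi k : sin (k%:R * pi) = 0 :> R.
Proof.
elim: k => [|k IH]; first by rewrite mul0r sin0.
by rewrite -natr1 mulrDl mul1r sinDpi IH oppr0.
Qed.

Lemma cos_natpi k : cos (k%:R * pi) = (-1) ^+ k :> R.
Proof.
elim: k => [|k IH]; first by rewrite mul0r cos0.
by rewrite -natr1 mulrDl mul1r cosDpi IH exprS mulN1r.
Qed.

Lemma sin_odd_pihalf n : sin ((2 * n + 1)%:R * (pi / 2)) = (-1) ^+ n :> R.
Proof.
have -> : (2 * n + 1)%:R * (pi / 2) = n%:R * pi + pi / 2 :> R.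
  by rewrite natrD natrM; field.
by rewrite sinDpihalf cos_natpi.
Qed.

Lemma cos_odd_pihalf n : cos ((2 * n + 1)%:R * (pi / 2)) = 0 :> R.
Proof.
have -> : (2 * n + 1)%:R * (pi / 2) = n%:R * pi + pi / 2 :> R.
  by rewrite natrD natrM; field.
by rewrite cosDpihalf sin_natpi oppr0.
Qed.

End Trig.

(** * Hyperbolic functions *)

Definition sinh (R : realType) (x : R) : R := (expR x - expR (- x)) / 2.

Section Hyperbolic.
Context {R : realType}.
Implicit Types (x : R).

Lemma is_derive_expRN x : is_derive x 1 (fun t => expR (- t)) (- expR (- x)).
Proof.
have h := @is_derive_dilate R (-1) (@expR R) x (expR (-1 * x)) (is_derive_expR _).
move: h; rewrite !mulN1r; congr (is_derive _ _ _ _).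
by apply/funext => t; rewrite mulN1r.
Qed.

Lemma is_derive_cosh x : is_derive x 1 (@cosh R) (sinh x).
Proof.
rewrite /sinh /cosh [_ / 2]mulrC.
under eq_fun do rewrite mulrC.
by apply: is_derive_funZ; apply: is_derive_funD; exact: is_derive_expRN.
Qed.

Lemma is_derive_sinh x : is_derive x 1 (@sinh R) (cosh x).
Proof.
rewrite /sinh /cosh [_ / 2]mulrC.
under eq_fun do rewrite mulrC.
apply: is_derive_funZ; rewrite -[X in _ + X]opprK.
by apply: is_derive_funB; exact: is_derive_expRN.
Qed.

Lemma cosh0 : cosh 0 = 1 :> R.
Proof. by rewrite /cosh oppr0 expR0; field. Qed.

Lemma sinh0 : sinh 0 = 0 :> R.
Proof. by rewrite /sinh oppr0 subrr mul0r. Qed.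

Lemma cosh_gt0 x : 0 < cosh x.
Proof. by rewrite /cosh divr_gt0// addr_gt0 ?expR_gt0. Qed.

Lemma cosh_le_expR x : 0 <= x -> cosh x <= expR x.
Proof.
move=> x0; have : expR (- x) <= expR x by rewrite ler_expR; lra.
by rewrite /cosh; lra.
Qed.

End Hyperbolic.

(** * The odd Dirichlet kernel and its antiderivative against [cosh] *)

Section DirichletKernel.
Context {R : realType}.
Implicit Types (t y : R) (n N : nat).

Lemma sin_mul_dirichlet N t :
  sin t * \sum_(n < N) cos ((2 * n + 1)%:R * t) = sin ((2 * N)%:R * t) / 2.
Proof.
elim: N => [|N IH]; first by rewrite big_ord0 mulr0 muln0 mul0r sin0 mul0r.
rewrite big_ord_recr/= mulrDr IH.
have -> : (2 * N + 1)%:R * t = (2 * N)%:R * t + t by rewrite natrD mulrDl mul1r.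
have -> : (2 * N.+1)%:R * t = (2 * N)%:R * t + t *+ 2.
  by rewrite mulnS addnC natrD mulrDl [2%:R * _]mulr_natl.
by rewrite cosD sinD sin_mulr2n cos_mulr2n cos2sin2 !mulr2n; field.
Qed.

(** With its two end coefficients halved, this cosine polynomial is [cos t] times the odd kernel of
    [sin_mul_dirichlet]; written this way the product can be integrated term by term. *)
Lemma sin_mul_dirichlet_cos N t :
  sin t * (1 / 2 + (\sum_(k < N) cos ((2 * k.+1)%:R * t)) - cos ((2 * N)%:R * t) / 2)
  = sin ((2 * N)%:R * t) * cos t / 2.
Proof.
elim: N => [|N IH].
  by rewrite big_ord0 muln0 !mul0r sin0 cos0 !mul0r addr0 subrr mulr0.
rewrite big_ord_recr/=.
set S := \sum_(k < N) _ in IH *.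
have -> : (2 * N.+1)%:R * t = (2 * N)%:R * t + t *+ 2.
  by rewrite mulnS addnC natrD mulrDl [2%:R * _]mulr_natl.
rewrite cosD [sin (_ * _ + _)]sinD sin_mulr2n cos_mulr2n.
have c2 := cos2Dsin2 t.
set C := cos ((2 * N)%:R * t) in IH *; set D := sin ((2 * N)%:R * t) in IH *.
have -> : S = (S - C / 2) + C / 2 by rewrite subrK.
move: IH; rewrite -addrA; set W := S - C / 2 => IH.
have IH' : sin t * W = D * cos t / 2 - sin t / 2 by move: IH; lra.
rewrite !mulr2n.
set Z := C / 2 + (C * (cos t ^+ 2 * 2 - 1) - D * (cos t * sin t * 2)) / 2.
have EZ : sin t * Z = sin t * C * cos t ^+ 2 - D * cos t * sin t ^+ 2.
  by rewrite /Z; field.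
transitivity (sin t * W + sin t / 2 + sin t * Z); first by rewrite /Z; field.
rewrite IH' EZ.
have -> : sin t ^+ 2 = 1 - cos t ^+ 2 by rewrite -c2; ring.
by field.
Qed.

(* Antiderivative of [(\sum_(n < N) cos ((2n+1) t)) * (cosh (y t) - cos t)]: the
   term [cos t], whose integral over [[0, pi / 2]] is exactly [pi / 4], makes the
   second factor vanish at [0], where the Dirichlet kernel concentrates. *)
Definition dirichlet_antiderivative y N t : R :=
  (\sum_(n < N) ((2 * n + 1)%:R ^+ 2 + y ^+ 2)^-1 *
     ((2 * n + 1)%:R * (sin ((2 * n + 1)%:R * t) * cosh (y * t)) +
      y * (cos ((2 * n + 1)%:R * t) * sinh (y * t)))) -
  (1 / 2 * t + (\sum_(k < N) (2 * k.+1)%:R^-1 * sin ((2 * k.+1)%:R * t)) -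
    (2 * (2 * N)%:R)^-1 * sin ((2 * N)%:R * t)).

(** The first sum comes from integrating [cos (a t) * cosh (y t)] by parts twice. At [N = 0] the
    statement fails: the two halves [1 / 2] cancel on the right, but [(2 * 0)^-1 = 0] leaves nothing
    to cancel [1 / 2 * t]. *)
Lemma is_derive_dirichlet_antiderivative y N t : (0 < N)%N ->
  is_derive t 1 (dirichlet_antiderivative y N)
   ((\sum_(n < N) cos ((2 * n + 1)%:R * t)) * cosh (y * t) -
    (1 / 2 + (\sum_(k < N) cos ((2 * k.+1)%:R * t)) - cos ((2 * N)%:R * t) / 2)).
Proof.
move=> N0; rewrite /dirichlet_antiderivative mulr_suml.
apply: is_derive_funB.
  apply: (@is_derive_funsum R N (fun n t => ((2 * n + 1)%:R ^+ 2 + y ^+ 2)^-1 *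
     ((2 * n + 1)%:R * (sin ((2 * n + 1)%:R * t) * cosh (y * t)) +
      y * (cos ((2 * n + 1)%:R * t) * sinh (y * t))))
      (fun n t => cos ((2 * n + 1)%:R * t) * cosh (y * t))) => n.
  set a : R := (2 * n + 1)%:R.
  have a0 : 0 < a by rewrite ltr0n addn1.
  have ds := @is_derive_dilate R a (@sin R) t _ (is_derive_sin _).
  have dc := @is_derive_dilate R a (@cos R) t _ (is_derive_cos _).
  have dsh := @is_derive_dilate R y (@sinh R) t _ (is_derive_sinh _).
  have dch := @is_derive_dilate R y (@cosh R) t _ (is_derive_cosh _).
  have h := is_derive_funZ (a ^+ 2 + y ^+ 2)^-1 (is_derive_funD
     (is_derive_funZ a (is_derive_funM ds dch)) (is_derive_funZ y (is_derive_funM dc dsh))).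
  apply: (is_derive_eq h).
  have : a ^+ 2 + y ^+ 2 != 0 by rewrite gt_eqF// ltr_pwDl ?exprn_gt0 ?sqr_ge0.
  by clear ds dc dsh dch h; clearbody a; move=> ?; field.
apply: is_derive_funB.
  apply: is_derive_funD.
    by have := @is_derive_funZ R (1 / 2) id t 1 (is_derive_id _ _); rewrite mulr1.
  apply: (@is_derive_funsum R N (fun k t => (2 * k.+1)%:R^-1 * sin ((2 * k.+1)%:R * t))
     (fun k t => cos ((2 * k.+1)%:R * t))) => k.
  have ds := @is_derive_dilate R (2 * k.+1)%:R (@sin R) t _ (is_derive_sin _).
  apply: (is_derive_eq (is_derive_funZ _ ds)).
  by rewrite mulKf// pnatr_eq0.
have ds := @is_derive_dilate R (2 * N)%:R (@sin R) t _ (is_derive_sin _).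
apply: (is_derive_eq (is_derive_funZ _ ds)).
have : (2 * N)%:R != 0 :> R by rewrite pnatr_eq0 muln_eq0/= -lt0n.
by move: {ds} (2 * N)%:R => b b0; field.
Qed.

Lemma dirichlet_antiderivative0 y N : dirichlet_antiderivative y N 0 = 0.
Proof.
rewrite /dirichlet_antiderivative !mulr0 sin0 mulr0 subr0 !big1 ?addr0 ?subrr//.
  by move=> k _; rewrite mulr0 sin0 mulr0.
by move=> n _; rewrite !mulr0 sin0 sinh0 !(mul0r, mulr0) addr0 mulr0.
Qed.

(** At [pi / 2] the sines of even multiples and the cosines of odd multiples vanish, which isolates
    the partial sum of the sech series. *)
Lemma dirichlet_antiderivative_pihalf y N :
  dirichlet_antiderivative y N (pi / 2) =
  cosh (y * (pi / 2)) *
    (\sum_(n < N) (-1) ^+ n * (2 * n + 1)%:R / ((2 * n + 1)%:R ^+ 2 + y ^+ 2)) -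
  pi / 4.
Proof.
have s0 k : sin ((2 * k)%:R * (pi / 2)) = 0 :> R.
  have -> : (2 * k)%:R * (pi / 2) = k%:R * pi :> R by rewrite natrM; field.
  exact: sin_natpi.
rewrite /dirichlet_antiderivative s0 mulr0 subr0.
have -> : \sum_(k < N) (2 * k.+1)%:R^-1 * sin ((2 * k.+1)%:R * (pi / 2)) = 0 :> R.
  by rewrite big1// => k _; rewrite s0 mulr0.
rewrite addr0; congr (_ - _); last by field.
rewrite mulr_sumr; apply: eq_bigr => n _.
rewrite sin_odd_pihalf cos_odd_pihalf mul0r mulr0 addr0; ring.
Qed.

End DirichletKernel.

(** * The partial fraction expansion of sech *)

Section SechExpansion.
Context {R : realType}.
Variable y : R.
Hypothesis y0 : 0 <= y.
Implicit Types (t : R) (N : nat).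

(** An upper bound for [h''] on [[0, pi / 2]]. Since [h] and [h'] vanish at 0, it gives
    [|h'| <= K t] and then [|h| <= K t ^ 2], which absorbs the singularity of [1 / sin t]. *)
Let K := y ^+ 2 * expR (y * (pi / 2)) + 1.
Let h t := cosh (y * t) - cos t.
Let dh t := y * sinh (y * t) + sin t.

Let K0 : 0 <= K.
Proof. by rewrite addr_ge0// mulr_ge0 ?sqr_ge0 ?expR_ge0. Qed.

Let is_derive_h t : is_derive t 1 h (dh t).
Proof.
rewrite /dh -[sin t]opprK; apply: is_derive_funB.
exact/is_derive_dilate/is_derive_cosh.
Qed.

Let dh_bound t : 0 <= t <= pi / 2 -> `|dh t| <= K * t.
Proof.
move=> /andP[t0 tpi].
have := @mvt_bound R dh (fun t => y * (y * cosh (y * t)) + cos t) 0 t K t0.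
rewrite /dh mulr0 sinh0 sin0 mulr0 addr0 !subr0; apply=> x /andP[x0 xt].
  apply: is_derive_funD; apply: is_derive_funZ.
  exact/is_derive_dilate/is_derive_sinh.
rewrite (le_trans (ler_normD _ _))// lerD ?cos_max//.
rewrite 2!normrM (ger0_norm y0) (ger0_norm (ltW (cosh_gt0 _))) mulrA -expr2.
rewrite ler_wpM2l ?sqr_ge0// (le_trans (cosh_le_expR _)) ?mulr_ge0//.
by rewrite ler_expR ler_wpM2l// (le_trans xt).
Qed.

Let h_bound t : 0 <= t <= pi / 2 -> `|h t| <= K * t * t.
Proof.
move=> /andP[t0 tpi].
have := @mvt_bound R h dh 0 t (K * t) t0.
have -> : h 0 = 0 by rewrite /h mulr0 cosh0 cos0 subrr.
rewrite !subr0; apply=> x /andP[x0 xt].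
  exact: is_derive_h.
by rewrite (le_trans (dh_bound _)) ?x0 ?(le_trans xt)// ler_wpM2l.
Qed.

(* [sin (2 N t) * g t] is the derivative of the antiderivative above; as [g] has
   a bounded derivative, an integration by parts bounds its integral by [C / N]. *)
Let g t := h t * (2 * sin t)^-1.

Let inv_bound t : 0 < t <= pi / 2 -> 0 < sin t /\ (2 * sin t)^-1 <= t^-1.
Proof.
move=> /andP[t0 tpi].
have hs : t / 2 <= sin t by apply: ler_half_sin; rewrite (ltW t0).
have s0 : 0 < sin t by rewrite (lt_le_trans _ hs)// divr_gt0.
split=> //; rewrite lef_pV2 ?posrE ?mulr_gt0//.
by move: hs; lra.
Qed.

Let g_bound t : 0 < t <= pi / 2 -> `|g t| <= K * t.
Proof.
move=> tI; have [s0 sV] := inv_bound tI; move/andP: tI => [t0 tpi].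
have i0 : 0 <= (2 * sin t)^-1 by rewrite invr_ge0 mulr_ge0 ?ltW.
rewrite normrM (ger0_norm i0).
apply: (@le_trans _ _ (K * t * t * t^-1)); last by rewrite mulfK// gt_eqF.
by rewrite ler_pM// h_bound// (ltW t0).
Qed.

Let dg t := h t * (- (2 * cos t) / (2 * sin t) ^+ 2) + (2 * sin t)^-1 * dh t.

Let is_derive_g t : 0 < t <= pi / 2 -> is_derive t 1 g (dg t).
Proof.
move=> tI; have [s0 sV] := inv_bound tI.
apply: is_derive_funM; first exact: is_derive_h.
by apply: is_derive_funV; rewrite mulf_neq0// gt_eqF.
Qed.

Let dg_bound t : 0 < t <= pi / 2 -> `|dg t| <= 3 * K.
Proof.
move=> tI; have [s0 sV] := inv_bound tI; move/andP: tI => [t0 tpi].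
have tI : 0 <= t <= pi / 2 by rewrite ltW.
have i0 : 0 <= (2 * sin t)^-1 by rewrite invr_ge0 mulr_ge0 ?ltW.
rewrite (le_trans (ler_normD _ _))//.
apply: (@le_trans _ _ (K * t * t * (2 * (t^-1 * t^-1)) + t^-1 * (K * t))); last first.
  have tn0 : t != 0 by rewrite gt_eqF.
  by rewrite le_eqVlt; apply/orP; left; apply/eqP; field.
apply: lerD; rewrite normrM; last first.
  by rewrite ler_pM// ?dh_bound// ger0_norm.
rewrite ler_pM// ?h_bound// normrM ler_pM//.
  by rewrite normrN normrM ger0_norm// ler_piMr// cos_max.
by rewrite -exprVn expr2 normrM (ger0_norm i0) ler_pM.
Qed.

(** The integral of [dg] contributes [3 K * pi / 2] and the two boundary terms [K * pi / 2] each;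
    the sum is divided by [2 N]. *)
Let C := 5 * K * pi / 4.

(** The left end stays away from 0, where the quotient [g] is only a default value; the bound does
    not depend on [d], so that [d] may tend to 0 afterwards. *)
Let antiderivative_bound N d : (0 < N)%N -> 0 < d < pi / 2 ->
  `|dirichlet_antiderivative y N (pi / 2) - dirichlet_antiderivative y N d| <=
  C * N%:R^-1.
Proof.
move=> N0 /andP[d0 dpi].
have b0 : 0 < (2 * N)%:R :> R by rewrite ltr0n muln_gt0.
have bi : 0 <= (2 * N)%:R^-1 :> R by rewrite invr_ge0 ltW.
(* Adding the boundary term of the integration by parts leaves a derivative that contains only the
   bounded [dg], with a factor [1 / (2 N)]. *)
pose Psi t := dirichlet_antiderivative y N t +
  (2 * N)%:R^-1 * (cos ((2 * N)%:R * t) * g t).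
pose dPsi t := (2 * N)%:R^-1 * (cos ((2 * N)%:R * t) * dg t).
have PsiE : `|Psi (pi / 2) - Psi d| <= (2 * N)%:R^-1 * (3 * K) * (pi / 2 - d).
  apply: (@mvt_bound R Psi dPsi); first exact: ltW.
    move=> t /andP[dt tpi].
    have tI : 0 < t <= pi / 2 by rewrite (lt_le_trans d0 dt).
    have [s0 _] := inv_bound tI.
    have dc := @is_derive_dilate R (2 * N)%:R (@cos R) t _ (is_derive_cos _).
    have H := is_derive_funD (is_derive_dirichlet_antiderivative y t N0)
      (is_derive_funZ (2 * N)%:R^-1 (is_derive_funM dc (is_derive_g tI))).
    apply: (is_derive_eq H); rewrite /dPsi.
    set P := (X in X + _ = _).
    have PE : P = sin ((2 * N)%:R * t) * g t.
      apply: (@mulfI _ (sin t)); first by rewrite gt_eqF.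
      rewrite /P mulrBr mulrA sin_mul_dirichlet sin_mul_dirichlet_cos /g /h.
      have sn0 : sin t != 0 by rewrite gt_eqF.
      move: (sin (_ * t)) (cosh _) (cos t) sn0 => u v w sn0.
      by move: (sin t) sn0 => s sn0; field.
    rewrite PE mulrDr addrCA -[RHS]addr0; congr (_ + _).
    by rewrite [X in _ + X]mulrCA mulKf ?gt_eqF// mulrN mulrC subrr.
  move=> t /andP[dt tpi].
  rewrite normrM (ger0_norm bi).
  rewrite ler_wpM2l// normrM -[leRHS]mul1r ler_pM ?cos_max//.
  by apply: dg_bound; rewrite (lt_le_trans d0 dt).
have corr t : 0 < t <= pi / 2 ->
    `|(2 * N)%:R^-1 * (cos ((2 * N)%:R * t) * g t)| <= (2 * N)%:R^-1 * (K * (pi / 2)).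
  move=> /[dup] tI /andP[t0 tpi].
  rewrite normrM (ger0_norm bi).
  rewrite ler_wpM2l// normrM -[leRHS]mul1r ler_pM ?cos_max//.
  by rewrite (le_trans (g_bound tI))// ler_wpM2l.
have c1 := corr (pi / 2) _; have c2 := corr d _.
have pi0 := @pi_gt0 R.
have {}c1 := c1 ltac:(apply/andP; split; lra).
have {}c2 := c2 ltac:(apply/andP; split; lra).
set u := _^-1 * _ in c1; set v := _^-1 * _ in c2.
have -> : dirichlet_antiderivative y N (pi / 2) - dirichlet_antiderivative y N d =
  (Psi (pi / 2) - Psi d) - u + v by rewrite /Psi -/u -/v; ring.
rewrite (le_trans (ler_normD _ _))//.
rewrite (le_trans (lerD (ler_normB _ _) (lexx _)))//.
apply: le_trans (lerD (lerD PsiE c1) c2) _.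
have -> : C * N%:R^-1 = (2 * N)%:R^-1 * (5 * K * pi / 2).
  rewrite /C natrM; have : N%:R != 0 :> R by rewrite pnatr_eq0 -lt0n.
  by move: (N%:R : R) => n n0; field.
rewrite -mulrA -!mulrDr ler_wpM2l//.
have : 0 <= K * d by rewrite mulr_ge0// ltW.
lra.
Qed.

Lemma cvg_sech_series :
  (\sum_(n < N) (-1) ^+ n * (2 * n + 1)%:R / ((2 * n + 1)%:R ^+ 2 + y ^+ 2))
    @[N --> \oo] --> pi / 4 * sech (y * (pi / 2)).
Proof.
have Phi_le N : (0 < N)%N ->
    `|dirichlet_antiderivative y N (pi / 2)| <= C * N%:R^-1.
  move=> N0; apply/ler_addgt0Pl => e e0.
  have cPhi : {for 0, continuous (dirichlet_antiderivative y N)}.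
    apply/differentiable_continuous/derivable1_diffP.
    have H := is_derive_dirichlet_antiderivative y 0 N0.
    exact: ex_derive.
  move/cvgrPdist_lt : cPhi => /(_ _ e0); rewrite dirichlet_antiderivative0.
  move=> [r /= r0 hr].
  (* Small enough for continuity at 0, and strictly inside the interval on which
     [antiderivative_bound] applies. *)
  pose d := Num.min (r / 2) (pi / 4).
  have d0 : 0 < d by rewrite lt_min !divr_gt0// pi_gt0.
  have dr : d <= r / 2 by rewrite ge_min lexx.
  have dpi : d <= pi / 4 by rewrite ge_min lexx orbT.
  have pi0 := @pi_gt0 R.
  have hd : `|0 - dirichlet_antiderivative y N d| < e.
    by apply: hr => /=; rewrite sub0r normrN ger0_norm ?ltW//; lra.
  rewrite sub0r normrN in hd.
  rewrite -[X in `|X|](subrK (dirichlet_antiderivative y N d)).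
  rewrite (le_trans (ler_normD _ _))// addrC lerD ?(ltW hd)//.
  by apply: antiderivative_bound => //; apply/andP; split; lra.
have Phi0 : dirichlet_antiderivative y N (pi / 2) @[N --> \oo] --> 0.
  rewrite -cvg_shiftS; apply/norm_cvg0P.
  apply: (@squeeze_cvgr _ _ _ _ (cst 0) (fun n => C * n.+1%:R^-1)).
  - by apply: nearW => n /=; rewrite normr_ge0/= Phi_le.
  - exact: cvg_cst.
  - rewrite -[X in _ --> X](mulr0 C); apply: cvgMl_tmp.
    exact: cvg_harmonic.
have ch0 : cosh (y * (pi / 2)) != 0 by rewrite gt_eqF ?cosh_gt0.
have -> : (fun N => \sum_(n < N) (-1) ^+ n * (2 * n + 1)%:R /
      ((2 * n + 1)%:R ^+ 2 + y ^+ 2)) =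
    (fun N => (dirichlet_antiderivative y N (pi / 2) + pi / 4) * sech (y * (pi / 2))).
  apply/funext => N; rewrite dirichlet_antiderivative_pihalf subrK /sech.
  by rewrite mulrAC divff// mul1r.
have h1 : (dirichlet_antiderivative y N (pi / 2) + pi / 4) @[N --> \oo] --> 0 + pi / 4.
  by apply: cvgD => //; exact: cvg_cst.
by rewrite add0r in h1; exact: (cvgMr_tmp h1).
Qed.

End SechExpansion.

(** * Jacobi's identity for the cube of the eta function *)

Section QPochhammer.
Context {R : realType}.
Implicit Types (q : R) (n k N : nat).

Definition qpoch q n : R := \prod_(k < n) (1 - q ^+ k.+1).

Lemma qpochS q n : qpoch q n.+1 = qpoch q n * (1 - q ^+ n.+1).
Proof. by rewrite /qpoch big_ord_recr. Qed.

(* The coefficient of [z ^ (- n)] in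
   [\prod_(k < N.+1) (1 - z * q ^+ k) * \prod_(k < N) (1 - q ^+ k.+1 / z)]. *)
Definition triple_coef q N n : R :=
  if (n <= N)%N then
    (-1) ^+ n * q ^+ 'C(n.+1, 2) *
    (qpoch q (2 * N + 1) / (qpoch q (N - n) * qpoch q (N + n + 1)))
  else 0.

Variable q : R.
Hypothesis q01 : 0 < q < 1.

Let q0 : 0 < q. Proof. by case/andP: q01. Qed.
Let q1 : q < 1. Proof. by case/andP: q01. Qed.

Lemma qpoch_factor_gt0 n : 0 < 1 - q ^+ n.+1.
Proof. by rewrite subr_gt0 exprn_ilt1 ?ltW. Qed.

Lemma qpoch_gt0 n : 0 < qpoch q n.
Proof. by apply: prodr_gt0 => k _; exact: qpoch_factor_gt0. Qed.

Let P k : qpoch q k != 0. Proof. by rewrite gt_eqF// qpoch_gt0. Qed.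

Let F k : 1 - q ^+ k.+1 != 0.
Proof. by rewrite gt_eqF// qpoch_factor_gt0. Qed.

Let qpoch_odd_succ N : qpoch q (2 * N.+1 + 1) = qpoch q (2 * N + 1) *
    (1 - q ^+ (2 * N + 2)) * (1 - q ^+ (2 * N + 3)).
Proof.
have -> : (2 * N.+1 + 1 = (2 * N + 1).+2)%N by lia.
by rewrite !qpochS; congr (_ * (1 - _ ^+ _) * (1 - _ ^+ _)); lia.
Qed.

(** Passing from [N] to [N.+1] multiplies the product by [(1 - z q^(N+1)) (1 - q^(N+1) / z) = 1 +
    q^(2N+2) - q^(N+1) (z + 1/z)]; this compares coefficients. *)
Lemma triple_coef_succ N n :
  triple_coef q N.+1 n.+1 = (1 + q ^+ (2 * N + 2)) * triple_coef q N n.+1 -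
    q ^+ N.+1 * (triple_coef q N n + triple_coef q N n.+2).
Proof.
have qE : q ^+ 'C(n.+2, 2) = q ^+ 'C(n.+1, 2) * q ^+ n.+1.
  by rewrite binS bin1 exprD.
have qE' : q ^+ 'C(n.+3, 2) = q ^+ 'C(n.+1, 2) * q ^+ n.+1 * q ^+ n.+2.
  by rewrite binS bin1 exprD qE.
have E1 := qpoch_odd_succ N.
rewrite /triple_coef ltnS qE qE' E1 !exprS.
have [ltNn|leNn] := ltnP N n.
  by rewrite !ifN -?ltnNge ?leqW// ?(ltnW ltNn)// addr0 !mulr0 subrr.
have := P (2 * N + 1); move: (qpoch q (2 * N + 1)) => T T0.
move: ((-1) ^+ n) (q ^+ 'C(n.+1, 2)) => s c.
(* The cases record which of the coefficients of index [n.+1] and [n.+2] at level [N] fall outside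
   the support: both, only the second, or neither. *)
have [NE|[NE|[k NE]]] : N = n \/ N = n.+1 \/ exists k, N = (n + k.+2)%N.
- case: (ltngtP N n) leNn => // nN _; last by left.
  case: (ltngtP N n.+1) nN => // nN _; last by right; left.
  by right; right; exists (N - n.+2)%N; lia.
- rewrite {N}NE in leNn E1 *; rewrite !ltnn ltnNge leqnSn/= !subnn.
  have -> : (n.+1 + n.+1 + 1 = (n + n + 1).+2)%N by lia.
  rewrite !qpochS.
  have Fa : 1 - q ^+ (n + n + 1).+1 != 0 := F _.
  have Fb : 1 - q ^+ (n + n + 1).+2 != 0 := F _.
  have Ea : q ^+ (2 * n + 2) = q ^+ (n + n + 1).+1 by congr (_ ^+ _); lia.
  have Eb : q ^+ (2 * n + 3) = q ^+ (n + n + 1).+2 by congr (_ ^+ _); lia.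
  rewrite Ea Eb.
  move: (P 0) (P (n + n + 1)) Fa Fb.
  move: (q ^+ _.+1) (q ^+ _.+2) (qpoch q 0) (qpoch q _) (q ^+ n) => u v x y a x0 y0 Fa Fb.
  by field; rewrite x0 y0 Fa Fb.
- rewrite {N}NE in leNn E1 *; rewrite ltnSn ltnn subnn !subSnn.
  have -> : (n.+2 + n.+1 + 1 = (n + n + 2).+2)%N by lia.
  have -> : (n.+1 + n.+1 + 1 = (n + n + 2).+1)%N by lia.
  have -> : (n.+1 + n + 1 = n + n + 2)%N by lia.
  rewrite !qpochS.
  have Fa : 1 - q ^+ (n + n + 2).+1 != 0 := F _.
  have Fb : 1 - q ^+ (n + n + 2).+2 != 0 := F _.
  have Fc : 1 - q != 0 := F 0.
  (* Splitting all powers into the atoms [q] and [q ^+ n] turns the goal into a rational identity in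
     independent variables, within reach of [field]. *)
  have Ea : q ^+ (n + n + 2).+1 = q ^+ n * q ^+ n * q * q * q.
    by rewrite -!exprD -!exprSr; congr (_ ^+ _); lia.
  have Eb : q ^+ (n + n + 2).+2 = q ^+ n * q ^+ n * q * q * q * q.
    by rewrite -!exprD -!exprSr; congr (_ ^+ _); lia.
  have Ec : q ^+ (2 * n.+1 + 2) = q ^+ n * q ^+ n * q * q * q * q.
    by rewrite -!exprD -!exprSr; congr (_ ^+ _); lia.
  have Ed : q ^+ (2 * n.+1 + 3) = q ^+ n * q ^+ n * q * q * q * q * q.
    by rewrite -!exprD -!exprSr; congr (_ ^+ _); lia.
  rewrite Ea in Fa *; rewrite Eb in Fb *; rewrite Ec Ed expr1 (exprSr q n).
  move: (P 0) (P (n + n + 2)) Fa Fb.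
  move: (qpoch q 0) (qpoch q _) (q ^+ n) => x y a x0 y0 Fa Fb.
  by field; rewrite x0 y0 Fa Fb Fc.
- rewrite {N}NE in leNn E1 *.
  have -> : (n < n + k.+2)%N by lia.
  have -> : (n.+1 < n + k.+2)%N by lia.
  have -> : ((n + k.+2).+1 - n.+1 = k.+2)%N by lia.
  have -> : ((n + k.+2) - n.+1 = k.+1)%N by lia.
  have -> : ((n + k.+2) - n = k.+2)%N by lia.
  have -> : ((n + k.+2) - n.+2 = k)%N by lia.
  have -> : ((n + k.+2).+1 + n.+1 + 1 = (n + n + k + 3).+2)%N by lia.
  have -> : ((n + k.+2) + n.+2 + 1 = (n + n + k + 3).+2)%N by lia.
  have -> : ((n + k.+2) + n.+1 + 1 = (n + n + k + 3).+1)%N by lia.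
  have -> : ((n + k.+2) + n + 1 = n + n + k + 3)%N by lia.
  rewrite !qpochS.
  have Fa : 1 - q ^+ (n + n + k + 3).+1 != 0 := F _.
  have Fb : 1 - q ^+ (n + n + k + 3).+2 != 0 := F _.
  have Fc : 1 - q ^+ k.+1 != 0 := F k.
  have Fd : 1 - q ^+ k.+2 != 0 := F k.+1.
  have Ea : q ^+ (n + n + k + 3).+1 = q ^+ n * q ^+ n * q ^+ k * q * q * q * q.
    by rewrite -!exprD -!exprSr; congr (_ ^+ _); lia.
  have Eb : q ^+ (n + n + k + 3).+2 = q ^+ n * q ^+ n * q ^+ k * q * q * q * q * q.
    by rewrite -!exprD -!exprSr; congr (_ ^+ _); lia.
  have Ec : q ^+ (2 * (n + k.+2) + 2) = q ^+ n * q ^+ n * q ^+ k * q ^+ k *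
      q * q * q * q * q * q.
    by rewrite -!exprD -!exprSr; congr (_ ^+ _); lia.
  have Ed : q ^+ (2 * (n + k.+2) + 3) = q ^+ n * q ^+ n * q ^+ k * q ^+ k *
      q * q * q * q * q * q * q.
    by rewrite -!exprD -!exprSr; congr (_ ^+ _); lia.
  have Ee : q ^+ (n + k.+2) = q ^+ n * q ^+ k * q * q.
    by rewrite -!exprD -!exprSr; congr (_ ^+ _); lia.
  rewrite Ea in Fa *; rewrite Eb in Fb *; rewrite !exprSr in Fc Fd *.
  rewrite Ec Ed Ee.
  move: (P k) (P (n + n + k + 3)) Fa Fb Fc Fd.
  move: (qpoch q k) (qpoch q _) (q ^+ n) (q ^+ k) => x y a b x0 y0 Fa Fb Fc Fd.
  by field; rewrite x0 y0 Fa Fb Fc Fd.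
Qed.

(* The coefficient of [z] is minus that of [1]. *)
Lemma triple_coef_succ0 N :
  triple_coef q N.+1 0 = (1 + q ^+ (2 * N + 2)) * triple_coef q N 0 -
    q ^+ N.+1 * (triple_coef q N 1 - triple_coef q N 0).
Proof.
have E1 := qpoch_odd_succ N.
rewrite /triple_coef !leq0n E1 !expr0 mul1r.
have -> : 'C(2, 2) = 1%N by [].
rewrite expr1 !subn0 !addn0.
have := P (2 * N + 1); move: (qpoch q (2 * N + 1)) => T T0.
case: N E1 => [|k] E1.
- have -> : (2 * 0 + 2 = 2)%N by [].
  have -> : (2 * 0 + 3 = 3)%N by [].
  have -> : (1 + 1 = 2)%N by [].
  have -> : (0 + 1 = 1)%N by [].
  rewrite ltnn !qpochS.
  have Fc : 1 - q ^+ 1 != 0 := F 0.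
  have Fb : 1 - q ^+ 2 != 0 := F 1.
  have F3 : 1 - q ^+ 3 != 0 := F 2.
  rewrite !exprSr expr0 mul1r in Fc Fb F3 *.
  move: (P 0) Fb F3.
  move: (qpoch q 0) => x x0 Fb F3.
  by field; rewrite ?x0 ?Fb ?Fc ?F3.
have -> : (1 <= k.+1)%N by [].
have -> : (k.+1 - 1 = k)%N by lia.
have -> : (k.+1 + 1 + 1 = k.+3)%N by lia.
have -> : (k.+2 + 1 = k.+3)%N by lia.
have -> : (k.+1 + 1 = k.+2)%N by lia.
rewrite !qpochS.
have Fc : 1 - q ^+ k.+1 != 0 := F k.
have Fd : 1 - q ^+ k.+2 != 0 := F k.+1.
have Fe : 1 - q ^+ k.+3 != 0 := F k.+2.
have Ec : q ^+ (2 * k.+1 + 2) = q ^+ k * q ^+ k * q * q * q * q.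
  by rewrite -!exprD -!exprSr; congr (_ ^+ _); lia.
have Ed : q ^+ (2 * k.+1 + 3) = q ^+ k * q ^+ k * q * q * q * q * q.
  by rewrite -!exprD -!exprSr; congr (_ ^+ _); lia.
rewrite Ec Ed {Ec Ed}; rewrite !exprSr in Fc Fd Fe *.
move: (P k) Fc Fd Fe.
move: (qpoch q k) (q ^+ k) => x b x0 Fc Fd Fe.
by rewrite expr0; field; rewrite ?x0 ?Fc ?Fd ?Fe.
Qed.

(** Away from the ends [c j] is counted [(2j+3) + (2j-1) = 2 (2j+1)] times: linear weights have zero
    second difference. The term [c 1 - c 0] repairs the lower end. *)
Lemma odd_weighted_shift_sum (c : nat -> R) M :
  \sum_(i < M) (2 * i.+1 + 1)%:R * (c i + c i.+2) + (c 1 - c 0) =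
  2 * (\sum_(i < M) (2 * i + 1)%:R * c i) +
  ((2 * M + 1)%:R * c M.+1 + (2 * M%:R - 1) * c M).
Proof.
elim: M => [|M IH]; first by rewrite !big_ord0 mulr0 muln0; ring.
by rewrite !big_ord_recr/= addrAC IH; ring.
Qed.

(** Pairing [z^(-n)] with [z^(n+1)], whose coefficients are opposite, and dividing by [1 - z] gives
    the weight [2n+1] at [z = 1], while the product becomes [qpoch q N ^+ 2]. By the recurrence,
    each step multiplies the moment by [1 + q^(2N+2) - 2 q^(N+1) = (1 - q^(N+1)) ^ 2]. *)
Lemma triple_coef_moment N :
  \sum_(n < N.+1) (2 * n + 1)%:R * triple_coef q N n = qpoch q N ^+ 2.
Proof.
(* The upper limit is freed because the inductive step uses the hypothesis at both [M] and [M.+1];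
   the additional coefficients vanish. *)
suff H M : (N < M)%N -> \sum_(n < M) (2 * n + 1)%:R * triple_coef q N n = qpoch q N ^+ 2.
  exact: H.
elim: N M => [|N IH] M NM.
  case: M NM => // M _; rewrite big_ord_recl big1 => [|i _].
    have E : qpoch q 0 = 1 by rewrite /qpoch big_ord0.
    have -> : triple_coef q 0 0 = 1.
      rewrite /triple_coef leqnn subnn E mul1r.
      by rewrite (_ : 2 * 0 + 1 = 0 + 0 + 1)%N// divff// mulr1 !expr0 mulr1.
    by rewrite E expr1n addr0 mulr1.
  by rewrite /triple_coef/= mulr0.
have c0 n : (N < n)%N -> triple_coef q N n = 0.
  by rewrite /triple_coef ltnNge => /negbTE ->.
case: M NM => // M NM; rewrite big_ord_recl/= triple_coef_succ0.
under eq_bigr => i _ do rewrite /bump/= triple_coef_succ.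
have S1 : triple_coef q N 0 + \sum_(i < M) (2 * i.+1 + 1)%:R * triple_coef q N i.+1 =
    qpoch q N ^+ 2.
  by rewrite -(IH M.+1 (ltnW NM)) big_ord_recl/= mul1r.
have S2 : \sum_(n < M) (2 * n + 1)%:R * triple_coef q N n = qpoch q N ^+ 2.
  exact: IH.
have S3 := odd_weighted_shift_sum (triple_coef q N) M.
rewrite S2 (c0 M.+1 (ltnW NM)) in S3.
rewrite (c0 M NM) !mulr0 !addr0 in S3.
have -> : \sum_(i < M) (2 * i.+1 + 1)%:R * ((1 + q ^+ (2 * N + 2)) *
    triple_coef q N i.+1 - q ^+ N.+1 * (triple_coef q N i + triple_coef q N i.+2)) =
  (1 + q ^+ (2 * N + 2)) * (\sum_(i < M) (2 * i.+1 + 1)%:R * triple_coef q N i.+1)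
  - q ^+ N.+1 * (\sum_(i < M) (2 * i.+1 + 1)%:R * (triple_coef q N i + triple_coef q N i.+2)).
  by rewrite !mulr_sumr -sumrB; apply: eq_bigr => i _; ring.
have -> : q ^+ (2 * N + 2) = q ^+ N.+1 ^+ 2 by rewrite -exprM; congr (_ ^+ _); lia.
rewrite qpochS; move: S1 S3.
set A := \sum_(i < M) (2 * i.+1 + 1)%:R * triple_coef q N i.+1.
set B := \sum_(i < M) (2 * i.+1 + 1)%:R * (triple_coef q N i + _).
move: (triple_coef q N 0) (triple_coef q N 1) (qpoch q N) (q ^+ N.+1) A B.
rewrite muln0 add0n => u v w p A B S1 S3.
have -> : B = 2 * w ^+ 2 - (v - u) by rewrite -S3; ring.
have -> : A = w ^+ 2 - u by rewrite -S1; ring.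
by ring.
Qed.

End QPochhammer.

(** * Tannery's theorem and an explicit summable majorant *)

Section Tannery.
Context {R : realType}.
Implicit Types (q : R) (n N : nat).

Lemma cvg_tannery (f : nat -> nat -> R) (h g : nat -> R) :
  (forall N n, `|f N n| <= g n) ->
  (forall n, f N n @[N --> \oo] --> h n) ->
  cvgn (series g) ->
  (\sum_(n < N.+1) (f N n - h n)) @[N --> \oo] --> 0.
Proof.
move=> fg fh cg.
have g0 n : 0 <= g n by rewrite (le_trans _ (fg 0%N n)).
have hg n : `|h n| <= g n.
  apply: (ler_cvg_to (cvg_norm (fh n)) (cvg_cst (g n))).
  by apply: nearW => N; exact: fg.
have ndg : nondecreasing_seq (series g) by apply: nondecreasing_series.
apply/cvgr0Pnorm_lt => e e0.
(* Each difference is at most [2 * g n], so a tail of [g] below [e / 4] costs less than [e / 2], the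
   rest being left for the first [K] terms. *)
have e4 : 0 < e / 4 by rewrite divr_gt0.
have [K _ hK] : \forall k \near \oo, `|limn (series g) - series g k| < e / 4.
  by move/cvgrPdist_lt : cg; apply.
have fin0 : (\sum_(n < K) (f N n - h n)) @[N --> \oo] --> 0.
  elim: K {hK} => [|K IH].
    by under eq_cvg do rewrite big_ord0; exact: cvg_cst.
  under eq_cvg do rewrite big_ord_recr/=.
  have D : (f N K - h K) @[N --> \oo] --> h K - h K.
    by apply: cvgB; [exact: fh|exact: cvg_cst].
  rewrite subrr in D.
  have E : (\sum_(n < K) (f N n - h n) + (f N K - h K)) @[N --> \oo] --> 0 + 0.
    exact: cvgD.
  by rewrite addr0 in E.
near=> N.
have KN : (K <= N.+1)%N by near: N; exists K => // ? /= /leqW.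
rewrite -(big_mkord xpredT (fun n => f N n - h n)).
rewrite (big_cat_nat_idem _ _ KN)//=; last exact: addr0.
have E1 : `|\sum_(0 <= n < K) (f N n - h n)| < e / 2.
  rewrite big_mkord; near: N; apply: cvgr0_norm_lt => //.
  by rewrite divr_gt0.
have E2 : `|\sum_(K <= n < N.+1) (f N n - h n)| <= 2 * \sum_(K <= n < N.+1) g n.
  rewrite mulr_sumr (le_trans (ler_norm_sum _ _ _))// ler_sum// => n _.
  by rewrite (le_trans (ler_normB _ _))// mulr_natl mulr2n lerD.
have E3 : \sum_(K <= n < N.+1) g n <= limn (series g) - series g K.
  rewrite -sub_series_geq// lerB//.
  exact: nondecreasing_cvgn_le.
have E4 := le_lt_trans (ler_norm _) (hK K (leqnn K)).
rewrite (le_lt_trans (ler_normD _ _))//; lra.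
Unshelve. all: by end_near. Qed.

Lemma sum_odd_geometric q N :
  (1 - q) ^+ 2 * (\sum_(n < N) (2 * n + 1)%:R * q ^+ n) =
  1 + q - q ^+ N * ((2 * N + 1)%:R - (2 * N%:R - 1) * q).
Proof.
elim: N => [|N IH]; first by rewrite big_ord0 expr0 !mulr0 sub0r mulN1r opprK mul1r subrr.
by rewrite big_ord_recr/= mulrDr IH (exprSr q N); ring.
Qed.

Lemma sum_odd_geometric_le q N : 0 < q < 1 ->
  \sum_(n < N) (2 * n + 1)%:R * q ^+ n <= (1 + q) / (1 - q) ^+ 2.
Proof.
move=> /andP[q0 q1].
rewrite ler_pdivlMr ?exprn_gt0 ?subr_gt0// mulrC sum_odd_geometric.
rewrite gerBl mulr_ge0 ?exprn_ge0 ?ltW// natrD natrM subr_gt0.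
have : N%:R * q <= N%:R by rewrite ler_piMr// ltW.
lra.
Qed.

Lemma is_cvg_series_odd_geometric q : 0 < q < 1 ->
  cvgn (series (fun n => (2 * n + 1)%:R * q ^+ n)).
Proof.
move=> q01; have /andP[q0 _] := q01; apply: nondecreasing_is_cvgn.
  by apply: nondecreasing_series => n _ _; rewrite mulr_ge0// exprn_ge0// ltW.
by exists ((1 + q) / (1 - q) ^+ 2) => _ [N _ <-]; rewrite seriesEord sum_odd_geometric_le.
Qed.

End Tannery.

Section JacobiCube.
Context {R : realType}.
Variable q : R.
Hypothesis q01 : 0 < q < 1.
Implicit Types (n N : nat).

Definition qpochoo (q : R) : R := limn (qpoch q).

Let q0 : 0 < q. Proof. by case/andP: q01. Qed.
Let q1 : q < 1. Proof. by case/andP: q01. Qed.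

Lemma qpoch_nonincreasing : nonincreasing_seq (qpoch q).
Proof.
apply/nonincreasing_seqP => n; rewrite qpochS ler_piMr ?(ltW (qpoch_gt0 q01 n))//.
by rewrite gerBl exprn_ge0// ltW.
Qed.

(* [1 - t >= exp (- t / (1 - t))] factor by factor. *)
Lemma qpoch_ge n : expR (- (q / (1 - q) ^+ 2)) <= qpoch q n.
Proof.
have s0 : 0 < 1 - q by rewrite subr_gt0.
suff H : expR (- (\sum_(k < n) q ^+ k.+1 / (1 - q))) <= qpoch q n.
  apply: le_trans H; rewrite ler_expR lerN2.
  have E : (1 - q) ^+ 2 * (\sum_(k < n) q ^+ k.+1 / (1 - q)) = q * (1 - q ^+ n).
    elim: n => [|n IH]; first by rewrite big_ord0 mulr0 expr0 subrr mulr0.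
    rewrite big_ord_recr/= mulrDr IH (exprS q n).
    by field; rewrite gt_eqF.
  rewrite ler_pdivlMr ?exprn_gt0// mulrC E ler_piMr ?(ltW q0)//.
  by rewrite gerBl exprn_ge0// ltW.
rewrite -sumrN expR_sum ler_prod// => k _; rewrite expR_ge0/=.
have t0 : 0 < q ^+ k.+1 by rewrite exprn_gt0.
have tq : q ^+ k.+1 <= q by rewrite exprS ler_piMr ?exprn_ile1// ltW.
rewrite expRN -[leRHS]invrK lef_pV2 ?posrE ?expR_gt0 ?invr_gt0 ?qpoch_factor_gt0//.
apply: le_trans (expR_ge1Dx _).
have f0 := qpoch_factor_gt0 q01 k.
rewrite -[leLHS]mul1r ler_pdivrMr//.
set t := q ^+ k.+1 in t0 tq f0 *.
have : (1 - t) * t <= (1 - t) / (1 - q) * t.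
  by rewrite ler_wpM2r ?(ltW t0)// ler_peMr ?(ltW f0)// invf_ge1 ?(ltW t0)//; lra.
have : t * (1 - t) / (1 - q) >= t.
  rewrite ler_pdivlMr// ler_wpM2l ?(ltW t0)//; lra.
by rewrite mulrDl mul1r mulrAC; lra.
Qed.

Lemma cvg_qpoch : qpoch q @ \oo --> qpochoo q.
Proof.
apply: nonincreasing_is_cvgn; first exact: qpoch_nonincreasing.
by exists 0 => _ [n _ <-]; rewrite ltW// qpoch_gt0.
Qed.

(** Monotone convergence alone would allow the limit 0; the uniform bound [qpoch_ge] excludes it, so
    that one may divide by [qpochoo q]. *)
Lemma qpochoo_gt0 : 0 < qpochoo q.
Proof.
apply: lt_le_trans (expR_gt0 _) _.
apply: (ler_cvg_to (cvg_cst _) cvg_qpoch).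
by apply: nearW => n; exact: qpoch_ge.
Qed.

Lemma qpochoo_le n : qpochoo q <= qpoch q n.
Proof.
apply: nonincreasing_cvgn_ge; first exact: qpoch_nonincreasing.
by apply/cvg_ex; exists (qpochoo q); exact: cvg_qpoch.
Qed.

Lemma cvg_triple_coef n :
  triple_coef q N n @[N --> \oo] --> (-1) ^+ n * q ^+ 'C(n.+1, 2) / qpochoo q.
Proof.
have L0 := qpochoo_gt0.
have c1 : qpoch q (2 * N + 1) @[N --> \oo] --> qpochoo q.
  apply: (cvg_comp (fun N => 2 * N + 1)%N _ _ cvg_qpoch).
  by move=> A [M _ MA]; exists M => // k /= Mk; apply: MA => /=; lia.
have c2 : qpoch q (N - n) @[N --> \oo] --> qpochoo q.
  apply: (cvg_comp (fun N => N - n)%N _ _ cvg_qpoch).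
  by move=> A [M _ MA]; exists (M + n)%N => // k /= Mk; apply: MA => /=; lia.
have c3 : qpoch q (N + n + 1) @[N --> \oo] --> qpochoo q.
  apply: (cvg_comp (fun N => N + n + 1)%N _ _ cvg_qpoch).
  by move=> A [M _ MA]; exists M => // k /= Mk; apply: MA => /=; lia.
have : ((-1) ^+ n * q ^+ 'C(n.+1, 2) * (qpoch q (2 * N + 1) /
    (qpoch q (N - n) * qpoch q (N + n + 1)))) @[N --> \oo] -->
    (-1) ^+ n * q ^+ 'C(n.+1, 2) * (qpochoo q / (qpochoo q * qpochoo q)).
  apply: cvgMl_tmp; apply: cvgM => //; apply: cvgV; last exact: cvgM.
  by rewrite mulf_neq0// gt_eqF.
have -> : qpochoo q / (qpochoo q * qpochoo q) = (qpochoo q)^-1.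
  by rewrite invfM mulVKf// gt_eqF.
apply: cvg_trans.
apply: near_eq_cvg; near=> N; rewrite /triple_coef ifT//.
by near: N; exists n.
Unshelve. all: by end_near. Qed.

(** The majorant for Tannery: ['C(n.+1, 2) >= n], and [qpoch q (2 * N + 1) <= qpoch q (N + n + 1)]
    because [n <= N]. *)
Lemma triple_coef_le N n :
  `|triple_coef q N n| <= q ^+ n / qpochoo q.
Proof.
have L0 := qpochoo_gt0; have qn0 k : 0 <= q ^+ k by rewrite exprn_ge0 ?ltW.
rewrite /triple_coef; case: ifPn => [nN|_]; last first.
  by rewrite normr0 divr_ge0 ?(ltW L0).
have P k : 0 <= qpoch q k by rewrite ltW ?qpoch_gt0.
rewrite normrM normrM normrX normrN1 expr1n mul1r.
have F0 : 0 <= qpoch q (2 * N + 1) / (qpoch q (N - n) * qpoch q (N + n + 1)).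
  by rewrite divr_ge0 ?mulr_ge0.
rewrite (ger0_norm F0) (ger0_norm (qn0 _)).
apply: ler_pM => //.
  apply: ler_wiXn2l; rewrite ?(ltW q0) ?(ltW q1)//.
  by rewrite binS bin1 leq_addl.
rewrite invfM mulrCA -[leRHS]mulr1 ler_pM ?invr_ge0 ?divr_ge0//.
  by rewrite lef_pV2 ?posrE ?qpoch_gt0// qpochoo_le.
rewrite ler_pdivrMr ?qpoch_gt0// mul1r; apply: qpoch_nonincreasing; lia.
Qed.

Lemma jacobi_cube :
  (\sum_(n < N) (-1) ^+ n * (2 * n + 1)%:R * q ^+ 'C(n.+1, 2)) @[N --> \oo]
    --> qpochoo q ^+ 3.
Proof.
have L0 := qpochoo_gt0.
(* The limiting coefficients carry a factor [1 / qpochoo q], while the finite moments tend to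
   [qpochoo q ^+ 2]; clearing the denominator produces the cube. *)
pose h n := (2 * n + 1)%:R * ((-1) ^+ n * q ^+ 'C(n.+1, 2) / qpochoo q).
have T : (\sum_(n < N.+1) ((2 * n + 1)%:R * triple_coef q N n - h n))
    @[N --> \oo] --> 0.
  apply: (@cvg_tannery R (fun N n => (2 * n + 1)%:R * triple_coef q N n) h
    (fun n => (2 * n + 1)%:R * q ^+ n * (qpochoo q)^-1)).
  - move=> N n; rewrite normrM ger0_norm// -mulrA ler_wpM2l//.
    exact: triple_coef_le.
  - by move=> n; apply: cvgMl_tmp; exact: cvg_triple_coef.
  - have -> : series (fun n => (2 * n + 1)%:R * q ^+ n / qpochoo q) =
        (fun N => series (fun n => (2 * n + 1)%:R * q ^+ n) N * (qpochoo q)^-1).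
      by apply/funext => N; rewrite /series/= mulr_suml.
    apply: is_cvgMr_tmp; exact: is_cvg_series_odd_geometric.
have S : (\sum_(n < N.+1) h n) @[N --> \oo] --> qpochoo q ^+ 2.
  have -> : (fun N => \sum_(n < N.+1) h n) = (fun N => qpoch q N * qpoch q N -
      \sum_(n < N.+1) ((2 * n + 1)%:R * triple_coef q N n - h n)).
    by apply/funext => N; rewrite sumrB triple_coef_moment// expr2 opprB addrC subrK.
  rewrite expr2 -[qpochoo q * qpochoo q]subr0.
  by apply: cvgB => //; apply: cvgM; exact: cvg_qpoch.
rewrite -cvg_shiftS exprSr.
have -> : [sequence \sum_(n < N.+1) (-1) ^+ n * (2 * n + 1)%:R * q ^+ 'C(n.+1, 2)]_N =
    (fun N => (\sum_(n < N.+1) h n) * qpochoo q).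
  apply/funext => N; rewrite /= mulr_suml; apply: eq_bigr => n _; rewrite /h.
  by field; rewrite gt_eqF.
exact: (cvgMr_tmp S).
Qed.

End JacobiCube.

(** * Termwise integration *)

(* The partial sums of [(-1)^n (2n+1)] are [(-1)^n (n+1)]; summing by parts
   there and back turns the weights into 1. *)
Lemma abel_odd_alternating (R : realType) (e : nat -> R) N :
  nonincreasing_seq e -> (forall n, 0 <= e n) ->
  `|\sum_(n < N) (-1) ^+ n * (2 * n + 1)%:R * e n| <= \sum_(n < N) e n.
Proof.
move=> de e0.
(* This is the same inequality for the shifted sequence [e n - c]. With [c := e N] the last term
   disappears, which makes the induction work. *)
suff H c : 0 <= c -> (forall k, (k < N)%N -> c <= e k) ->
    `|\sum_(n < N) (-1) ^+ n * (2 * n + 1)%:R * e n + (-1) ^+ N * N%:R * c| <=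
    \sum_(n < N) e n - N%:R * c.
  by have := H 0 (lexx _) (fun k _ => e0 k); rewrite !mulr0 addr0 subr0.
elim: N c => [|N IH] c c0 ce; first by rewrite !big_ord0 !mulr0 mul0r addr0 normr0 subr0.
rewrite !big_ord_recr/=; have ceN := ce N (leqnn _).
set S := \sum_(n < N) _ * e n in IH *; set T := \sum_(n < N) e n in IH *.
have -> : S + (-1) ^+ N * (2 * N + 1)%:R * e N + (-1) ^+ N.+1 * N.+1%:R * c =
   (S + (-1) ^+ N * N%:R * e N) + (-1) ^+ N * (N.+1%:R * (e N - c)).
  by rewrite exprS; ring.
rewrite (le_trans (ler_normD _ _))//.
have -> : T + e N - N.+1%:R * c = (T - N%:R * e N) + N.+1%:R * (e N - c) by ring.
rewrite lerD//; first by apply: IH => // k kN; apply: de; exact: ltnW.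
by rewrite normrM normrX normrN1 expr1n mul1r ger0_norm// mulr_ge0// subr_ge0.
Qed.

Section Exchange.
Context d (T : measurableType d) (R : realType).
Variables (mu : {measure set T -> \bar R}) (D : set T) (mD : measurable D).
Variables (e : nat -> T -> R) (E f : T -> R).
Hypothesis me : forall n, measurable_fun D (e n).
Hypothesis mf : measurable_fun D f.
Hypothesis e0 : forall n x, D x -> 0 <= e n x.
Hypothesis f0 : forall x, D x -> 0 <= f x.
Hypothesis de : forall x, D x -> nonincreasing_seq (e ^~ x).
Hypothesis eE : forall x, D x ->
  (\sum_(n < N) (-1) ^+ n * (2 * n + 1)%:R * e n x) @[N --> \oo] --> E x.
Hypothesis foo : (\sum_(n <oo) \int[mu]_(x in D) (e n x * f x)%:E < +oo)%E.

Let mef n : measurable_fun D (EFin \o (fun x => e n x * f x)).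
Proof. by apply/measurable_EFinP; exact: measurable_funM. Qed.

Let ef0 n x : D x -> (0 <= (e n x * f x)%:E)%E.
Proof. by move=> Dx; rewrite lee_fin mulr_ge0 ?e0 ?f0. Qed.

Let ief n : mu.-integrable D (EFin \o (fun x => e n x * f x)).
Proof.
apply/integrableP; split; first exact: mef.
have -> : (\int[mu]_(x in D) `|(EFin \o (fun x => e n x * f x)%R) x| =
    \int[mu]_(x in D) (e n x * f x)%:E)%E.
  by apply: eq_integral => x /set_mem Dx; rewrite gee0_abs//=; exact: ef0.
apply: le_lt_trans foo.
have := @nneseries_lim_ge R (fun n => \int[mu]_(x in D) (e n x * f x)%:E)%E
   xpredT 0 n.+1.
rewrite big_nat_recr//=; move=> H; apply: le_trans (H _); last first.
  by move=> k _ _; apply: integral_ge0 => x; exact: ef0.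
rewrite leeDr// sume_ge0// => k _; apply: integral_ge0 => x; exact: ef0.
Qed.

Let F N x : R := (\sum_(n < N) (-1) ^+ n * (2 * n + 1)%:R * (e n x * f x)).

Let FE N x : F N x = (\sum_(n < N) (-1) ^+ n * (2 * n + 1)%:R * e n x) * f x.
Proof. by rewrite mulr_suml; apply: eq_bigr => n _; rewrite mulrA. Qed.

Let int_F N : (\int[mu]_(x in D) (F N x)%:E =
  (\sum_(n < N) (-1) ^+ n * (2 * n + 1)%:R * \int[mu]_(x in D) (e n x * f x))%:E)%E.
Proof.
under eq_integral do rewrite /F -sumEFin.
rewrite integral_sum//; last first.
  by move=> n; under eq_fun do rewrite EFinM; apply: integrableZl => //; exact: ief.
rewrite -sumEFin; apply: eq_bigr => n _.
under eq_integral do rewrite EFinM.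
rewrite integralZl//; last exact: ief.
by rewrite [RHS]EFinM fineK//; apply: integrable_fin_num => //; exact: ief.
Qed.

Lemma odd_alternating_exchange :
  mu.-integrable D (EFin \o (fun x => E x * f x)) /\
  (\sum_(n < N) (-1) ^+ n * (2 * n + 1)%:R * \int[mu]_(x in D) (e n x * f x))
    @[N --> \oo] --> \int[mu]_(x in D) (E x * f x).
Proof.
have mF N : measurable_fun D (EFin \o F N).
  apply/measurable_EFinP; rewrite /F.
  apply: measurable_sum => n; apply: measurable_funM; first exact: measurable_cst.
  exact/measurable_EFinP/mef.
have FEx x : D x -> (F N x)%:E @[N --> \oo] --> (E x * f x)%:E.
  move=> Dx; apply: cvg_EFin; first exact: nearW.
  rewrite /comp/=; under eq_cvg do rewrite FE.
  by apply: cvgMr_tmp; exact: eE.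
(* The majorant keeps extended real values: only its integral has to be finite, not its value at
   each point. *)
pose g x := (\sum_(n <oo) (e n x * f x)%:E)%E.
have mg : measurable_fun D g.
  by apply: ge0_emeasurable_sum => [n x Dx _|n _]; [exact: ef0|exact: mef].
have ig : mu.-integrable D g.
  apply/integrableP; split => //.
  have -> : (\int[mu]_(x in D) `|g x| = \int[mu]_(x in D) g x)%E.
    apply: eq_integral => x /set_mem Dx; rewrite gee0_abs//.
    by apply: nneseries_ge0 => n _ _; exact: ef0.
  by rewrite integral_nneseries//.
have mE : measurable_fun D (EFin \o (fun x => E x * f x)).
  by apply: (emeasurable_fun_cvg (fun N x => (F N x)%:E)).
have := @dominated_convergence _ _ _ mu D mD (fun N x => (F N x)%:E)
  (fun x => (E x * f x)%:E) g mF mE.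
case.
- by apply: aeW => x Dx; exact: FEx.
- exact: ig.
- apply: aeW => x N Dx; rewrite FE abse_EFin.
  apply: le_trans (@nneseries_lim_ge R (fun n => (e n x * f x)%:E) xpredT 0 N _); last first.
    by move=> n _ _; exact: ef0.
  rewrite sumEFin lee_fin normrM (ger0_norm (f0 Dx)) big_mkord -mulr_suml.
  rewrite ler_wpM2r ?f0//; apply: (@abel_odd_alternating R (e ^~ x)); first exact: de.
  by move=> n; exact: e0.
move=> iE _ cE; split; first exact: iE.
have -> : (fun N => \sum_(n < N) (-1) ^+ n * (2 * n + 1)%:R *
    \int[mu]_(x in D) (e n x * f x)) =
  fine \o (fun N => \int[mu]_(x in D) (F N x)%:E)%E.
  by apply/funext => N /=; rewrite int_F.
by apply: fine_cvg; rewrite fineK//; apply: integrable_fin_num.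
Qed.

End Exchange.

(** * Integrals of powers of eta on the imaginary axis *)

Section LaplaceExponential.
Context {R : realType}.
Implicit Types (c x : R).
Local Notation mu := (@lebesgue_measure R).

Lemma measurable_expRN c (D : set R) :
  measurable_fun D (fun x => expR (- (c * x))).
Proof.
apply: measurable_funTS; apply: measurableT_comp; first exact: measurable_expR.
by apply: measurableT_comp => //; exact: measurable_funM.
Qed.

Lemma integral_expRN c : 0 < c ->
  (\int[mu]_(x in `]0%R, +oo[) (expR (- (c * x)))%:E = (c^-1)%:E)%E.
Proof.
move=> c0.
have dF x : is_derive x 1 (fun x => - c^-1 * expR (- (c * x))) (expR (- (c * x))).
  have h := is_derive_dilate (is_derive_expRN (c * x)).
  apply: (is_derive_eq (is_derive_funZ (- c^-1) h)).
  by rewrite mulrN mulrNN mulKf// gt_eqF.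
have cE : continuous (fun x => expR (- (c * x))).
  move=> x; apply: continuous_comp; last exact: continuous_expR.
  apply: continuousN; apply: continuousM; first exact: cst_continuous.
  by [].
(* The fundamental theorem is applied on the closed half-line; the added endpoint is null. *)
rewrite integral_itv_obnd_cbnd; last first.
  by apply/measurable_EFinP; exact: measurable_expRN.
rewrite (@ge0_continuous_FTC2y _ _ (fun x => - c^-1 * expR (- (c * x))) _ 0)//.
- by rewrite mulr0 oppr0 expR0 mulr1 EFinN oppeK add0e.
- exact/continuous_subspaceT.
- rewrite -(mulr0 (- c^-1)); apply: cvgMl_tmp.
  apply: (@cvg_comp _ _ _ (fun x => c * x) (fun z => expR (- z)) _ (pinfty_nbhs R)).
    exact: gt0_cvgMry.
  exact: cvgr_expR.

- by apply/cvg_at_right_filter; apply: cvgMl_tmp; exact: cE.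
- by move=> x _; rewrite derive1E; exact: derive_val.
Qed.

Lemma nneseries_fin_bound (u : nat -> R) (C : R) : (forall n, 0 <= u n) ->
  (forall N, \sum_(n < N) u n <= C) -> (\sum_(n <oo) (u n)%:E <= C%:E)%E.
Proof.
move=> u0 uC; apply: lime_le.
  by apply: is_cvg_nneseries => n _ _; rewrite lee_fin.
by apply: nearW => N; rewrite sumEFin lee_fin big_mkord.
Qed.

End LaplaceExponential.

Section EtaPowers.
Context {R : realType}.
Implicit Types (a x : R) (m n N : nat).
Local Notation mu := (@lebesgue_measure R).
Local Notation D := (`]0%R, +oo[%classic : set R).

Definition theta_rate n : R := pi * (2 * n + 1)%:R ^+ 2 / 4.

(* [eta (i x)] *)
Definition eta_im x : R := expR (- (pi * x / 12)) * qpochoo (expR (- (2 * pi * x))).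

Lemma theta_rate_gt0 n : 0 < theta_rate n.
Proof. by rewrite divr_gt0// mulr_gt0 ?pi_gt0// exprn_gt0// ltr0n addn1. Qed.

Lemma theta_rate_nondecreasing m n : (m <= n)%N -> theta_rate m <= theta_rate n.
Proof.
move=> mn; rewrite ler_pM2r// ler_pM2l ?pi_gt0// lerXn2r ?nnegrE//.
by rewrite ler_nat; lia.
Qed.

Lemma expRN_in01 x : 0 < x -> 0 < expR (- (2 * pi * x)) < 1.
Proof.
move=> x0; rewrite expR_gt0/= expR_lt1 oppr_lt0.
by rewrite mulr_gt0// mulr_gt0// pi_gt0.
Qed.

Lemma eta_im_ge0 x : 0 < x -> 0 <= eta_im x.
Proof.
by move=> x0; rewrite mulr_ge0 ?expR_ge0// ltW// qpochoo_gt0// expRN_in01.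
Qed.

Lemma natr_bin2 n : 'C(n.+1, 2)%:R = n%:R * (n%:R + 1) / 2 :> R.
Proof.
elim: n => [|n IH]; first by rewrite !mul0r.
by rewrite binS bin1 natrD IH -[n.+1%:R]natr1; field.
Qed.

(** The factor [q ^ (1/8)] of the cube completes the square: [1/4 + n (n + 1) = (2n+1) ^ 2 / 4]. *)
Lemma cvg_eta_cube x : 0 < x ->
  (\sum_(n < N) (-1) ^+ n * (2 * n + 1)%:R * expR (- (theta_rate n * x)))
    @[N --> \oo] --> eta_im x ^+ 3.
Proof.
move=> x0; have J := jacobi_cube (expRN_in01 x0).
rewrite /eta_im exprMn.
have -> : (fun N => \sum_(n < N) (-1) ^+ n * (2 * n + 1)%:R * expR (- (theta_rate n * x))) =
  (fun N => expR (- (pi * x / 12)) ^+ 3 *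
    \sum_(n < N) (-1) ^+ n * (2 * n + 1)%:R * expR (- (2 * pi * x)) ^+ 'C(n.+1, 2)).
  apply/funext => N; rewrite mulr_sumr; apply: eq_bigr => n _.
  rewrite mulrCA -expRM_natl -expRM_natl -expRD; congr (_ * expR _).
  by rewrite natr_bin2 /theta_rate natrD natrM; field.
exact: cvgMl_tmp.
Qed.

(** Measurability is read off the Jacobi series, so the infinite product need not be studied as a
    function of [x]. *)
Lemma measurable_eta_cube : measurable_fun D (fun x => eta_im x ^+ 3).
Proof.
apply: (@measurable_fun_cvg _ _ _ D (fun N x =>
  \sum_(n < N) (-1) ^+ n * (2 * n + 1)%:R * expR (- (theta_rate n * x)))).
  move=> N; apply: measurable_sum => n.
  by apply: measurable_funM => //; exact: measurable_expRN.
by move=> x; rewrite /= in_itv/= andbT; exact: cvg_eta_cube.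
Qed.

Lemma eta_cube_exchange (f : R -> R) : measurable_fun D f ->
  (forall x, 0 < x -> 0 <= f x) ->
  (\sum_(n <oo) \int[mu]_(x in D) (expR (- (theta_rate n * x)) * f x)%:E < +oo)%E ->
  mu.-integrable D (EFin \o (fun x => eta_im x ^+ 3 * f x)) /\
  (\sum_(n < N) (-1) ^+ n * (2 * n + 1)%:R *
     \int[mu]_(x in D) (expR (- (theta_rate n * x)) * f x))
    @[N --> \oo] --> \int[mu]_(x in D) (eta_im x ^+ 3 * f x).
Proof.
move=> mf f0 foo.
apply: (@odd_alternating_exchange _ _ R mu D _ (fun n x => expR (- (theta_rate n * x)))) => //.
- by move=> n; exact: measurable_expRN.
- by move=> x; rewrite /= in_itv/= andbT; exact: f0.
- move=> x; rewrite /= in_itv/= andbT => x0 m n mn.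
  by rewrite ler_expR lerN2 ler_wpM2r ?(ltW x0)// theta_rate_nondecreasing.
- by move=> x; rewrite /= in_itv/= andbT; exact: cvg_eta_cube.
Qed.

(** Comparison with a telescoping series: [pi >= 2] and [2 (2n+1) ^ 2 >= (n+1) (n+2)], the latter an
    equality at [n = 0]. *)
Lemma sum_inv_theta_rate_le a N : 0 < a ->
  \sum_(n < N) (theta_rate n + a)^-1 <= 4.
Proof.
move=> a0.
have H n : (theta_rate n + a)^-1 <= 4 / n.+1%:R - 4 / n.+2%:R.
  have -> : 4 / n.+1%:R - 4 / n.+2%:R = (n.+1%:R * n.+2%:R / 4)^-1 :> R.
    have : n.+1%:R != 0 :> R by rewrite pnatr_eq0.
    have : n.+2%:R != 0 :> R by rewrite pnatr_eq0.
    rewrite -[n.+2%:R]natr1; move: (n.+1%:R : R) => t t1 t0.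
    by field; rewrite t0 t1.
  rewrite lef_pV2 ?posrE ?divr_gt0 ?mulr_gt0 ?addr_gt0 ?theta_rate_gt0//.
  rewrite -[leLHS]addr0 lerD ?(ltW a0)// ler_pM2r//.
  apply: (@le_trans _ _ (2 * (2 * n + 1)%:R ^+ 2)); last first.
    by rewrite ler_pM2r ?pi_ge2// exprn_gt0// ltr0n addn1.
  by rewrite -natrX -!natrM ler_nat; nia.
apply: (@le_trans _ _ (4 - 4 / N.+1%:R)); last by rewrite gerBl divr_ge0.
elim: N => [|N IH]; first by rewrite big_ord0 divr1 subrr.
by rewrite big_ord_recr/= (le_trans (lerD IH (H N)))// addrA subrK.
Qed.

Lemma laplace_eta_cube a : 0 < a ->
  mu.-integrable D (EFin \o (fun x => eta_im x ^+ 3 * expR (- (a * x)))) /\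
  \int[mu]_(x in D) (eta_im x ^+ 3 * expR (- (a * x))) = sech (Num.sqrt (pi * a)).
Proof.
move=> a0.
have intE n : (\int[mu]_(x in D) (expR (- (theta_rate n * x)) * expR (- (a * x)))%:E =
    ((theta_rate n + a)^-1)%:E)%E.
  rewrite -integral_expRN ?addr_gt0 ?theta_rate_gt0//; apply: eq_integral => x _.
  by rewrite -expRD -opprD -mulrDl.
have foo : (\sum_(n <oo) \int[mu]_(x in D)
    (expR (- (theta_rate n * x)) * expR (- (a * x)))%:E < +oo)%E.
  under eq_eseriesr do rewrite intE.
  apply: (@le_lt_trans _ _ (4%:R%:E)); last exact: ltry.
  apply: nneseries_fin_bound => [n|N]; last exact: sum_inv_theta_rate_le.
  by rewrite invr_ge0 addr_ge0 ?ltW ?theta_rate_gt0.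
have [iE cE] := eta_cube_exchange (@measurable_expRN R a D) (fun x _ => expR_ge0 (- (a * x))) foo.
split => //; move: cE; under eq_cvg do under eq_bigr do rewrite /Rintegral intE /=.
move=> cE.
have pi0 := @pi_gt0 R.
(* Chosen so that [theta_rate n + a = pi / 4 * ((2n+1) ^ 2 + y ^ 2)]; then [y * (pi / 2)] is
   [sqrt (pi a)]. *)
pose y := 2 * Num.sqrt (a / pi).
have y0 : 0 <= y by rewrite mulr_ge0// sqrtr_ge0.
have y2 : y ^+ 2 = 4 * a / pi.
  have q0 : 0 <= a / pi by rewrite divr_ge0 ?ltW.
  by rewrite /y exprMn (sqr_sqrtr q0) -natrX mulrA.
have cS := cvg_sech_series y0.
have yE : y * (pi / 2) = Num.sqrt (pi * a).
  have -> : y * (pi / 2) = Num.sqrt (a / pi) * pi by rewrite /y; field.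
  rewrite -[X in _ * X](ger0_norm (ltW pi0)) -sqrtr_sqr -sqrtrM ?divr_ge0 ?ltW//.
  by congr Num.sqrt; rewrite expr2 mulrA divfK ?gt_eqF// mulrC.
rewrite yE in cS.
have cS' : (4 / pi * \sum_(n < N) (-1) ^+ n * (2 * n + 1)%:R / ((2 * n + 1)%:R ^+ 2 + y ^+ 2))
    @[N --> \oo] --> 4 / pi * (pi / 4 * sech (Num.sqrt (pi * a))).
  exact: cvgMl_tmp.
have E : 4 / pi * (pi / 4 * sech (Num.sqrt (pi * a))) = sech (Num.sqrt (pi * a)).
  have aux (p s : R) : p != 0 -> 4 / p * (p / 4 * s) = s by move=> ?; field.
  by rewrite aux// gt_eqF.
rewrite E in cS'.
have SE : (fun N => \sum_(n < N) (-1) ^+ n * (2 * n + 1)%:R * (theta_rate n + a)^-1) =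
  (fun N => 4 / pi * \sum_(n < N) (-1) ^+ n * (2 * n + 1)%:R / ((2 * n + 1)%:R ^+ 2 + y ^+ 2)).
  apply/funext => N; rewrite mulr_sumr; apply: eq_bigr => n _.
  have -> : (theta_rate n + a)^-1 = 4 / pi / ((2 * n + 1)%:R ^+ 2 + y ^+ 2).
    rewrite -invf_div; congr (_^-1).
    have aux (p t : R) : p != 0 -> p * t / 4 + a = (t + 4 * a / p) / (4 / p).
      by move=> ?; field.
    by rewrite y2 /theta_rate aux// gt_eqF.
  by rewrite mulrCA mulrA.
rewrite -SE in cS'.
have <- := cvg_lim (@norm_hausdorff _ _) cE.
exact: (cvg_lim (@norm_hausdorff _ _) cS').
Qed.

End EtaPowers.

(** * The ninth power and the double series *)

Section NinthPower.
Context {R : realType}.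
Implicit Types (a x : R) (m n N : nat).
Local Notation mu := (@lebesgue_measure R).
Local Notation D := (`]0%R, +oo[%classic : set R).
Local Notation r := (expR (-1) : R).

Definition theta_sech m n : R := sech (Num.sqrt (pi * (theta_rate m + theta_rate n))).

Lemma sech_ge0 x : 0 <= sech x.
Proof. by rewrite invr_ge0 ltW// cosh_gt0. Qed.

Lemma sech_le x : sech x <= 2 * expR (- x).
Proof.
rewrite /sech /cosh invf_div ler_wpM2l// expRN lef_pV2 ?posrE ?addr_gt0 ?invr_gt0 ?expR_gt0//.
by rewrite lerDl invr_ge0 expR_ge0.
Qed.

(** The argument of sech is [pi / 2 * sqrt ((2m+1) ^ 2 + (2n+1) ^ 2)], hence at least [m + n]. This
    crude bound separates the variables, and the weighted double sum factors into geometric-type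
    series. *)
Lemma theta_sech_le m n : theta_sech m n <= 2 * r ^+ m * r ^+ n.
Proof.
rewrite (le_trans (sech_le _))// -mulrA ler_wpM2l// -exprD -expRM_natl ler_expR.
rewrite mulrN1 lerN2 -[leLHS]ger0_norm// -sqrtr_sqr ler_wsqrtr//.
have -> : pi * (theta_rate m + theta_rate n) =
    pi ^+ 2 / 4 * ((2 * m + 1)%:R ^+ 2 + (2 * n + 1)%:R ^+ 2) :> R.
  by rewrite /theta_rate; move: (@pi R) => p; field.
apply: (@le_trans _ _ (1 * ((2 * m + 1)%:R ^+ 2 + (2 * n + 1)%:R ^+ 2))).
  by rewrite mul1r -!natrX -natrD ler_nat; nia.
rewrite ler_wpM2r ?addr_ge0 ?sqr_ge0// ler_pdivlMr// mul1r.
have -> : 4 = 2 ^+ 2 :> R by rewrite -natrX.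
by rewrite lerXn2r ?nnegrE ?pi_ge0// pi_ge2.
Qed.

(** The two arguments of sech agree since [(2m+1) ^ 2 + (2n+1) ^ 2 = 2 (2m(m+1) + 2n(n+1) + 1)]. *)
Lemma C9_termE m n : C9_term R m n =
  (-1) ^+ m * (2 * m + 1)%:R * ((-1) ^+ n * (2 * n + 1)%:R * theta_sech m n).
Proof.
rewrite /C9_term /theta_sech.
have -> : Num.sqrt (2 * m * (m + 1) + 2 * n * (n + 1) + 1)%:R * (pi / Num.sqrt 2) =
    Num.sqrt (pi * (theta_rate m + theta_rate n)) :> R.
  have s2 : Num.sqrt 2 != 0 :> R by rewrite gt_eqF// sqrtr_gt0.
  have -> : pi * (theta_rate m + theta_rate n) =
    (Num.sqrt (2 * m * (m + 1) + 2 * n * (n + 1) + 1)%:R * (pi / Num.sqrt 2)) ^+ 2 :> R.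
    rewrite exprMn expr_div_n !sqr_sqrtr// /theta_rate.
    by rewrite !natrD !natrM !natrD; move: (@pi R) => p; field.
  by rewrite sqrtr_sqr ger0_norm// mulr_ge0 ?sqrtr_ge0// divr_ge0 ?sqrtr_ge0 ?pi_ge0.
by rewrite exprD; ring.
Qed.

Let U : R := (1 + r) / (1 - r) ^+ 2.

Let r01 : 0 < r < 1. Proof. by rewrite expR_gt0 expR_lt1 ltrN10. Qed.

Let sum_u N : \sum_(n < N) (2 * n + 1)%:R * r ^+ n <= U.
Proof. exact: sum_odd_geometric_le. Qed.

Let rX0 n : 0 <= r ^+ n. Proof. by rewrite exprn_ge0// expR_ge0. Qed.

Let U0 : 0 <= U. Proof. by have := sum_u 0; rewrite big_ord0. Qed.

Let sum_sech m N : \sum_(n < N) (2 * n + 1)%:R * theta_sech m n <= 2 * U * r ^+ m.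
Proof.
apply: (@le_trans _ _ (2 * r ^+ m * \sum_(n < N) (2 * n + 1)%:R * r ^+ n)).
  rewrite mulr_sumr ler_sum// => n _.
  by rewrite mulrCA ler_wpM2l// theta_sech_le.
by rewrite mulrAC ler_wpM2r// ler_wpM2l.
Qed.

(** This is what entitles the iterated limit [C9] to be read as the double sum. *)
Lemma summable_C9_term :
  summable [set: nat * nat] (fun mn => (C9_term R mn.1 mn.2)%:E).
Proof.
rewrite /summable.
have C0 m n : `|C9_term R m n| = (2 * m + 1)%:R * ((2 * n + 1)%:R * theta_sech m n).
  rewrite C9_termE !normrM !normrX normrN1 !expr1n !mul1r !normr_nat.
  by rewrite ger0_norm// sech_ge0.
have -> : [set: nat * nat] = [set: nat] `*`` (fun=> [set: nat]).
  by apply/seteqP; split.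
rewrite -(esum_esum (a := fun m n => `|(C9_term R m n)%:E|%E)); last first.
  by move=> m n _ _; exact: abse_ge0.
rewrite -nneseries_esumT; last by move=> m; apply: esum_ge0 => n _; exact: abse_ge0.
have H m : (\esum_(n in [set: nat]) `|(C9_term R m n)%:E| <=
    ((2 * m + 1)%:R * (2 * U * r ^+ m))%:E)%E.
  rewrite -nneseries_esumT; last by move=> n; exact: abse_ge0.
  under eq_eseriesr do rewrite abse_EFin C0.
  apply: nneseries_fin_bound => [n|N].
    by rewrite mulr_ge0// mulr_ge0// sech_ge0.
  by rewrite -mulr_sumr ler_wpM2l.
apply: (@le_lt_trans _ _ (\sum_(m <oo) ((2 * m + 1)%:R * (2 * U * r ^+ m))%:E)%E).
  by apply: lee_nneseries => // m _ _; apply: esum_ge0 => n _; exact: abse_ge0.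
apply: (@le_lt_trans _ _ ((2 * U * U)%:E)); last exact: ltry.
apply: nneseries_fin_bound => [m|N].
  by rewrite mulr_ge0// mulr_ge0// mulr_ge0.
under eq_bigr do rewrite mulrCA.
by rewrite -mulr_sumr ler_wpM2l// mulr_ge0.
Qed.

Let cube_ge0 x : 0 < x -> 0 <= eta_im x ^+ 3.
Proof. by move=> x0; rewrite exprn_ge0// eta_im_ge0. Qed.

Lemma integral_expRN_eta_cube m n :
  mu.-integrable D (EFin \o (fun x =>
     expR (- (theta_rate n * x)) * (expR (- (theta_rate m * x)) * eta_im x ^+ 3))) /\
  \int[mu]_(x in D) (expR (- (theta_rate n * x)) *
    (expR (- (theta_rate m * x)) * eta_im x ^+ 3)) = theta_sech m n.
Proof.
have a0 : 0 < theta_rate m + theta_rate n :> R by rewrite addr_gt0 ?theta_rate_gt0.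
have E : (fun x => expR (- (theta_rate n * x)) * (expR (- (theta_rate m * x)) * eta_im x ^+ 3)) =
   (fun x => eta_im x ^+ 3 * expR (- ((theta_rate m + theta_rate n) * x))).
  by apply/funext => x; rewrite mulrA -expRD mulrC -opprD -mulrDl [theta_rate n + _]addrC.
by rewrite E; exact: laplace_eta_cube.
Qed.

Lemma integral_expRN_eta_sixth m :
  mu.-integrable D (EFin \o (fun x => expR (- (theta_rate m * x)) * eta_im x ^+ 6)) /\
  (\sum_(n < N) (-1) ^+ n * (2 * n + 1)%:R * theta_sech m n) @[N --> \oo] -->
    \int[mu]_(x in D) (expR (- (theta_rate m * x)) * eta_im x ^+ 6).
Proof.
have mf : measurable_fun D (fun x => expR (- (theta_rate m * x)) * eta_im x ^+ 3).
  apply: measurable_funM; first exact: measurable_expRN.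
  exact: measurable_eta_cube.
have f0 x : 0 < x -> 0 <= expR (- (theta_rate m * x)) * eta_im x ^+ 3.
  by move=> x0; rewrite mulr_ge0 ?expR_ge0// cube_ge0.
have intE n : (\int[mu]_(x in D) (expR (- (theta_rate n * x)) *
    (expR (- (theta_rate m * x)) * eta_im x ^+ 3))%:E = (theta_sech m n)%:E)%E.
  have [iE <-] := integral_expRN_eta_cube m n.
  by rewrite /Rintegral fineK//; apply: integrable_fin_num.
have [] := eta_cube_exchange mf f0.
  under eq_eseriesr do rewrite intE.
  apply: (@le_lt_trans _ _ ((2 * U * r ^+ m)%:E)); last exact: ltry.
  apply: nneseries_fin_bound => [n|N]; first exact: sech_ge0.
  (* The exchange asks for an unweighted sum; as [2n+1 >= 1], the weighted bound serves. *)
  apply: le_trans (sum_sech m N); apply: ler_sum => n _.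
  by rewrite ler_peMl ?sech_ge0// ler1n addn1.
have -> : (fun x => eta_im x ^+ 3 * (expR (- (theta_rate m * x)) * eta_im x ^+ 3)) =
  (fun x => expR (- (theta_rate m * x)) * eta_im x ^+ 6).
  by apply/funext => x; rewrite mulrCA -exprD.
move=> iE; under eq_cvg do under eq_bigr do rewrite /Rintegral intE /=.
by [].
Qed.

Lemma integral_eta_ninth :
  mu.-integrable D (EFin \o (fun x => eta_im x ^+ 9)) /\
  \int[mu]_(x in D) (eta_im x ^+ 9) = C9 R.
Proof.
pose T m : R := \int[mu]_(x in D) (expR (- (theta_rate m * x)) * eta_im x ^+ 6).
have f0 x : 0 < x -> 0 <= eta_im x ^+ 6.
  by move=> x0; rewrite exprn_ge0// eta_im_ge0.
have T0 m : 0 <= T m.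
  apply: Rintegral_ge0 => x; rewrite /= in_itv/= andbT => x0.
  by rewrite mulr_ge0 ?expR_ge0 ?f0.
have mf : measurable_fun D (fun x => eta_im x ^+ 6).
  have -> : (fun x => eta_im x ^+ 6) = (fun x => eta_im x ^+ 3 * eta_im x ^+ 3).
    by apply/funext => x; rewrite -exprD.
  by apply: measurable_funM; exact: measurable_eta_cube.
have TE m : (\int[mu]_(x in D) (expR (- (theta_rate m * x)) * eta_im x ^+ 6)%:E = (T m)%:E)%E.
  have [iE _] := integral_expRN_eta_sixth m.
  by rewrite /T /Rintegral fineK//; apply: integrable_fin_num.
have T_le m : T m <= 2 * U * r ^+ m.
  have [_ cT] := integral_expRN_eta_sixth m.
  apply: (ler_cvg_to cT (cvg_cst _)); apply: nearW => N.
  apply: le_trans (sum_sech m N); apply: ler_sum => n _.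
  rewrite ler_wpM2r ?sech_ge0// (le_trans (ler_norm _))// normrM normrX normrN1.
  by rewrite expr1n mul1r normr_nat.
have [] := eta_cube_exchange mf f0.
  under eq_eseriesr do rewrite TE.
  apply: (@le_lt_trans _ _ ((2 * U * U)%:E)); last exact: ltry.
  apply: nneseries_fin_bound => // N.
  apply: (@le_trans _ _ (2 * U * \sum_(n < N) (2 * n + 1)%:R * r ^+ n)); last first.
    by rewrite ler_wpM2l// mulr_ge0.
  rewrite mulr_sumr; apply: ler_sum => n _; apply: le_trans (T_le n) _.
  by rewrite ler_wpM2l ?mulr_ge0// ler_peMl// ler1n addn1.
have -> : (fun x => eta_im x ^+ 3 * eta_im x ^+ 6) = (fun x => eta_im x ^+ 9).
  by apply/funext => x; rewrite -exprD.
move=> iE cE; split => //; apply/esym.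
rewrite /C9; apply: (cvg_lim (@norm_hausdorff _ _)).
have -> : series (fun m => limn (series (C9_term R m))) =
   (fun N => \sum_(n < N) (-1) ^+ n * (2 * n + 1)%:R * T n).
  apply/funext => N; rewrite seriesEord/=; apply: eq_bigr => m _.
  apply: (cvg_lim (@norm_hausdorff _ _)).
  have -> : series (C9_term R m) = (fun N => (-1) ^+ m * (2 * m + 1)%:R *
      \sum_(n < N) (-1) ^+ n * (2 * n + 1)%:R * theta_sech m n).
    apply/funext => M; rewrite seriesEord/= mulr_sumr; apply: eq_bigr => n _.
    exact: C9_termE.
  by apply: cvgMl_tmp; have [] := integral_expRN_eta_sixth m.
exact: cE.
Qed.

End NinthPower.

(** * From the real function to the complex eta function *)

Local Open Scope complex_scope.

Section DedekindEta.
Context {R : realType}.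
Implicit Types (x : R).

Lemma cexp_real x : cexp x%:C = (expR x)%:C.
Proof. by rewrite /cexp /= cos0 sin0 mulr1. Qed.

Lemma cvg_real_complex (u : nat -> R) (l : R) : u @ \oo --> l ->
  (fun n => (u n)%:C : R[i]^o) @ \oo --> (l%:C : R[i]^o).
Proof.
move=> ul; apply/cvgrPdist_lt => e e0.
(* A positive element of [R[i]] is real, so the tolerance [e] has imaginary part 0 and [a] serves as
   the real tolerance. *)
case: e e0 => a b; rewrite ltcE /= => /andP[/eqP b0 a0].
move/cvgrPdist_lt : ul => /(_ _ a0); apply: filterS => n hn.
rewrite -rmorphB normc_def /= expr0n/= addr0 sqrtr_sqr b0 -[a +i* 0]/(a%:C).
by rewrite ltcR.
Qed.

(** At [i x] every exponent is a negative real, so the complex partial products are images of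
    [qpoch] and the limit can be taken in [R]. *)
Lemma dedekind_eta_im x : 0 < x -> dedekind_eta ('i * x%:C) = (eta_im x)%:C.
Proof.
move=> x0.
have iM (a : R) : a%:C * 'i * ('i * x%:C) = (- (a * x))%:C.
  by rewrite mulrA -(mulrA a%:C) -expr2 sqr_i mulrN1 mulNr -rmorphM rmorphN.
rewrite /dedekind_eta iM.
have -> : (- (pi * x))%:C / 12%:R = (- (pi * x / 12))%:C.
  by rewrite -(rmorph_nat (@real_complex R)) -fmorphV -rmorphM mulNr.
rewrite cexp_real /eta_im rmorphM; congr (_ * _).
have -> : (fun N : nat =>
    (\prod_(1 <= n < N.+1) (1 - cexp (2%:R * (@pi R)%:C * 'i * n%:R * ('i * x%:C)))
     : R[i]^o)) = (fun N => (qpoch (expR (- (2 * pi * x))) N)%:C : R[i]^o).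
  apply/funext => N; rewrite big_add1 big_mkord /qpoch rmorph_prod.
  apply: eq_bigr => n _; rewrite rmorphB rmorph1 -expRM_natl; congr (1 - _).
  rewrite -[RHS]cexp_real; congr cexp.
  have -> : 2%:R * pi%:C * 'i * n.+1%:R * ('i * x%:C) =
    n.+1%:R * ((2 * pi)%:C * 'i * ('i * x%:C)).
    by rewrite rmorphM rmorph_nat; ring.
  by rewrite iM -(rmorph_nat (@real_complex R)) -rmorphM.
have h := cvg_real_complex (cvg_qpoch (expRN_in01 x0)).
exact: (cvg_lim (@norm_hausdorff _ (R[i]^o)) h).
Qed.

End DedekindEta.

Theorem proposition3 (R : realType) :
  [/\ summable [set: nat * nat] (fun mn => (C9_term R mn.1 mn.2)%:E),
      cintegrable `]0, +oo[ (fun x : R => dedekind_eta ('i * x%:C) ^+ 9)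
    & cintegral `]0, +oo[ (fun x : R => dedekind_eta ('i * x%:C) ^+ 9)
      = (C9 R)%:C].
Proof.
have etaE x : x \in (`]0%R, +oo[%classic : set R) ->
    dedekind_eta ('i * x%:C) ^+ 9 = (eta_im x ^+ 9)%:C.
  by rewrite inE/= in_itv/= andbT => x0; rewrite dedekind_eta_im// rmorphXn.
have [iE cE] := @integral_eta_ninth R.
split; first exact: summable_C9_term.
  split.
    by apply: eq_integrable iE => // x xD; rewrite etaE.
  apply: (@eq_integrable _ _ _ _ _ _ (cst 0%E)) => //; first by move=> x xD; rewrite etaE.
  exact: integrable0.
rewrite /cintegral.
under eq_Rintegral => x xD do rewrite etaE //=.
rewrite cE; under eq_Rintegral => x xD do rewrite etaE //=.
by rewrite /Rintegral integral0.
Qed.
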